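(* Let $\mathfrak g$ be a semisimple Lie algebra over $\mathbb C$, let $M$ be a complex affine variety with algebra of functions $A$, let $\lambda,\lambda'$ be dominant weights of $\mathfrak g$, let $\{\mathcal Z\}_\lambda$ be a $\lambda$-multiset and $\{\mathcal Z'\}_{\lambda'}$ a $\lambda'$-multiset of points of $M$. Suppose that $\mathcal Z^{(i)}_j\neq(\mathcal Z')^{(i')}_{j'}$ for all $i,j,i',j'$. Then there is an isomorphism of $\mathfrak g\otimes A$-modules $$W_M(\{\mathcal Z\cup\mathcal Z'\}_{\lambda+\lambda'})\cong W_M(\{\mathcal Z\}_\lambda)\otimes W_M(\{\mathcal Z'\}_{\lambda'}).$$
   Context: All vector spaces and algebras are over $\mathbb C$. Let $r$ be the rank of $\mathfrak g$, $\mathfrak h\subset\mathfrak g$ a Cartan subalgebra, $\mathfrak n_+$ the nilpotent radical of the positive Borel subalgebra, $e_i,h_i,f_i$ ($i=1,\dots,r$) the Chevalley generators, $P\subset\mathfrak h^*$ the weight lattice. A $\mathfrak g$-module $V$ is integrable if there is a finite subset $D\subset P$ with $V=\bigoplus_{\mu\in D}V^\mu$, where each $h\in\mathfrak h$ acts on $V^\mu$ by the scalar $\mu(h)$ (the spaces $V^\mu$ may be infinite-dimensional). A $\mathfrak g\otimes A$-module is $\mathfrak g\otimes 1$-integrable if it is integrable over $\mathfrak g\cong\mathfrak g\otimes 1$. The bracket on $\mathfrak g\otimes A$ is $[x\otimes P,y\otimes Q]=[x,y]\otimes PQ$. $M$ may be singular. A weight $\lambda$ is dominant if all $\lambda_i=\lambda(h_i)$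 are non-negative integers. A $\lambda$-multiset $\{\mathcal Z\}_\lambda$ is a family of points $\mathcal Z^{(i)}_j\in M$ (not necessarily distinct), $i=1,\dots,r$, $j=1,\dots,\lambda_i$. The union multiset $\{\mathcal Z\cup\mathcal Z'\}_{\lambda+\lambda'}$ is the $(\lambda+\lambda')$-multiset obtained by taking, for each $i$, the multiset union of $\{\mathcal Z^{(i)}_j\}_j$ and $\{(\mathcal Z')^{(i)}_j\}_j$. The local Weyl module $W_M(\{\mathcal Z\}_\lambda)$ is the maximal $\mathfrak g\otimes 1$-integrable $\mathfrak g\otimes A$-module generated by a vector $v$ such that for all $P\in A$ and $i=1,\dots,r$ $$(\mathfrak n_+\otimes P)\,v=0,\qquad (h_i\otimes P)\,v=\sum_{j=1}^{\lambda_i}P(\mathcal Z^{(i)}_j)\,v .$$ ''Maximal'' means that any other such module is a quotient of it (generator mapping to generator). *)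

(* Defs.v *)
From HB Require Import structures.
From mathcomp Require mpoly.
(* Imported first and without notations: some of its names and notations clash
   with those of the libraries below. *)
Import -(notations) mpoly.
From mathcomp Require Import all_boot all_order all_algebra.
From mathcomp Require Import boolp classical_sets functions reals complex.

Set Implicit Arguments.
Unset Strict Implicit.
Unset Printing Implicit Defensive.

Import GRing.Theory.
Local Open Scope classical_set_scope.
Local Open Scope quotient_scope.
Local Open Scope ring_scope.

Local Notation is_bilinear f := (bilinear_for *:%R *:%R f).

Section LinearSpan.
Variables (K : fieldType) (V : lmodType K).

Definition is_subspace (U : set V) : Prop :=
  U 0 /\ forall (c : K) x y, U x -> U y -> U (c *: x + y).

Definition lspan (S : set V) : set V := smallest is_subspace S.

End LinearSpan.

Section Bilinear.
Variables (K : fieldType) (U V W : lmodType K) (f : U -> V -> W).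
Hypothesis bf : is_bilinear f.

Lemma bil0l v : f 0 v = 0.
Proof. by have := bf.1 v (-1) 0 0; rewrite /= scaler0 addr0 scaleN1r addNr. Qed.
Lemma bil0r u : f u 0 = 0.
Proof. by have := bf.2 u (-1) 0 0; rewrite /= scaler0 addr0 scaleN1r addNr. Qed.
Lemma bilDl v x y : f (x + y) v = f x v + f y v.
Proof. by have := bf.1 v 1 x y; rewrite /= !scale1r. Qed.
Lemma bilDr u x y : f u (x + y) = f u x + f u y.
Proof. by have := bf.2 u 1 x y; rewrite /= !scale1r. Qed.
Lemma bilZl c v x : f (c *: x) v = c *: f x v.
Proof. by have := bf.1 v c x 0; rewrite /= !addr0 bil0l addr0. Qed.
Lemma bilZr c u x : f u (c *: x) = c *: f u x.
Proof. by have := bf.2 u c x 0; rewrite /= !addr0 bil0r addr0. Qed.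
Lemma bilNl v x : f (- x) v = - f x v.
Proof. by rewrite -scaleN1r bilZl scaleN1r. Qed.
Lemma bilNr u x : f u (- x) = - f u x.
Proof. by rewrite -scaleN1r bilZr scaleN1r. Qed.

End Bilinear.

(* Every tensor is a finite sum of pure tensors, hence is represented by a
   list of pairs (v, w); two lists represent the same tensor when every
   bilinear map gives them the same value.  The universal property is
   tensor_lift_tens, tensor_lift_linear and tensor_ind. *)
Section Tensor.
Variables (K : fieldType) (V W : lmodType K).
Implicit Types s t : seq (V * W).

Definition bisum (U : lmodType K) (f : V -> W -> U) s : U :=
  \sum_(p <- s) f p.1 p.2.

Definition tensor_rel s t : bool :=
  `[< forall (U : lmodType K) (f : V -> W -> U),
        is_bilinear f -> bisum f s = bisum f t >].

Fact tensor_rel_refl : reflexive tensor_rel.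
Proof. by move=> s; apply/asboolP. Qed.

Fact tensor_rel_sym : symmetric tensor_rel.
Proof.
by move=> s t; apply/asboolP/asboolP => h U f bf; rewrite h.
Qed.

Fact tensor_rel_trans : transitive tensor_rel.
Proof.
move=> s t u /asboolP h /asboolP k; apply/asboolP => U f bf.
by rewrite h // k.
Qed.

Canonical tensor_equiv :=
  EquivRel tensor_rel tensor_rel_refl tensor_rel_sym tensor_rel_trans.

Definition tensor := {eq_quot tensor_equiv}.

HB.instance Definition _ := Choice.on tensor.

Implicit Types x y z : tensor.

Definition tens (v : V) (w : W) : tensor := \pi_tensor [:: (v, w)].

Definition tensor_lift (U : lmodType K) (f : V -> W -> U) x : U :=
  bisum f (repr x).

Lemma tensor_lift_pi (U : lmodType K) (f : V -> W -> U) s :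
  is_bilinear f -> tensor_lift f (\pi_tensor s) = bisum f s.
Proof.
move=> bf; rewrite /tensor_lift.
have /eqmodP/asboolP h : repr (\pi_tensor s) = s %[mod tensor] by rewrite reprK.
exact: h.
Qed.

Lemma tensor_ext x y :
  (forall (U : lmodType K) (f : V -> W -> U),
     is_bilinear f -> tensor_lift f x = tensor_lift f y) -> x = y.
Proof.
move=> h; rewrite -[x]reprK -[y]reprK; apply/eqmodP/asboolP => U f bf.
exact: h.
Qed.

Definition tensor_add x y : tensor := \pi_tensor (repr x ++ repr y).
Definition tensor_scale (c : K) x : tensor :=
  \pi_tensor [seq (c *: p.1, p.2) | p <- repr x].
Definition tensor_zero : tensor := \pi_tensor [::].

Section Lift.
Variables (U : lmodType K) (f : V -> W -> U) (bf : is_bilinear f).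

Fact tensor_lift_zero : tensor_lift f tensor_zero = 0.
Proof. by rewrite tensor_lift_pi // /bisum big_nil. Qed.

Fact tensor_lift_add x y :
  tensor_lift f (tensor_add x y) = tensor_lift f x + tensor_lift f y.
Proof. by rewrite tensor_lift_pi // /bisum big_cat. Qed.

Fact tensor_lift_scale c x :
  tensor_lift f (tensor_scale c x) = c *: tensor_lift f x.
Proof.
rewrite tensor_lift_pi // /bisum big_map /tensor_lift /bisum scaler_sumr.
apply: eq_bigr => p _ /=.
by rewrite (bilZl bf).
Qed.

End Lift.

Fact tensor_addA : associative tensor_add.
Proof. by move=> x y z; apply: tensor_ext => U f bf; rewrite !tensor_lift_add ?addrA. Qed.

Fact tensor_addC : commutative tensor_add.
Proof. by move=> x y; apply: tensor_ext => U f bf; rewrite !tensor_lift_add // addrC. Qed.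

Fact tensor_add0 : left_id tensor_zero tensor_add.
Proof.
by move=> x; apply: tensor_ext => U f bf; rewrite tensor_lift_add // tensor_lift_zero // add0r.
Qed.

Fact tensor_addN : left_inverse tensor_zero (tensor_scale (-1)) tensor_add.
Proof.
move=> x; apply: tensor_ext => U f bf.
by rewrite tensor_lift_add // tensor_lift_zero // tensor_lift_scale // scaleN1r addNr.
Qed.

HB.instance Definition _ :=
  GRing.isZmodule.Build tensor tensor_addA tensor_addC tensor_add0 tensor_addN.

Fact tensor_scaleA (a b : K) x :
  tensor_scale a (tensor_scale b x) = tensor_scale (a * b) x.
Proof. by apply: tensor_ext => U f bf; rewrite !tensor_lift_scale // scalerA. Qed.

Fact tensor_scale1 : left_id 1 tensor_scale.
Proof. by move=> x; apply: tensor_ext => U f bf; rewrite tensor_lift_scale // scale1r. Qed.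

Fact tensor_scaleDr : right_distributive tensor_scale +%R.
Proof.
move=> a x y; apply: tensor_ext => U f bf.
by rewrite !(tensor_lift_scale, tensor_lift_add) // scalerDr.
Qed.

Fact tensor_scaleDl x : {morph tensor_scale^~ x : a b / a + b}.
Proof.
move=> a b; apply: tensor_ext => U f bf.
by rewrite !(tensor_lift_scale, tensor_lift_add) // scalerDl.
Qed.

HB.instance Definition _ := GRing.Zmodule_isLmodule.Build K tensor
  tensor_scaleA tensor_scale1 tensor_scaleDr tensor_scaleDl.

Lemma tensor_lift_linear (U : lmodType K) (f : V -> W -> U) :
  is_bilinear f -> linear (tensor_lift f).
Proof.
by move=> bf c x y; rewrite tensor_lift_add // tensor_lift_scale.
Qed.

Lemma tensor_lift_tens (U : lmodType K) (f : V -> W -> U) v w :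
  is_bilinear f -> tensor_lift f (tens v w) = f v w.
Proof. by move=> bf; rewrite tensor_lift_pi // /bisum big_seq1. Qed.

Lemma tens_bilinear : is_bilinear tens.
Proof.
split=> [w|v] c x y; apply: tensor_ext => U f bf.
  by rewrite (tensor_lift_linear bf) !tensor_lift_tens // bf.1.
by rewrite (tensor_lift_linear bf) !tensor_lift_tens // bf.2.
Qed.

Lemma tensor_ind (P : tensor -> Prop) :
  P 0 -> (forall v w x, P x -> P (tens v w + x)) -> forall x, P x.
Proof.
move=> P0 PS x; rewrite -[x]reprK; elim: (repr x) => [|[v w] s IH].
  exact: P0.
suff -> : \pi_tensor ((v, w) :: s) = tens v w + \pi_tensor s by exact: PS.
apply: tensor_ext => U f bf.
by rewrite tensor_lift_add // !tensor_lift_pi // /bisum big_cons big_seq1.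
Qed.

End Tensor.

HB.mixin Record isLieAlgebra (K : fieldType) L of GRing.Lmodule K L := {
  lie : L -> L -> L;
  lie_bilinear : is_bilinear lie;
  liexx : forall x, lie x x = 0;
  lie_jacobi : forall x y z,
    lie x (lie y z) + lie y (lie z x) + lie z (lie x y) = 0
}.

#[short(type="lieAlgType")]
HB.structure Definition LieAlgebra (K : fieldType) :=
  {L of GRing.Lmodule K L & isLieAlgebra K L}.

#[short(type="finLieAlgType")]
HB.structure Definition FinLieAlgebra (K : fieldType) :=
  {L of Vector K L & LieAlgebra K L}.

Lemma lieC (K : fieldType) (L : lieAlgType K) (x y : L) : lie x y = - lie y x.
Proof.
apply/eqP; rewrite -addr_eq0; apply/eqP.
have := liexx (x + y).
by rewrite (bilDl lie_bilinear) !(bilDr lie_bilinear) !liexx add0r addr0.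
Qed.

Record lieModule (K : fieldType) (L : lieAlgType K) := LieModule {
  lmod_of :> lmodType K;
  act : L -> lmod_of -> lmod_of;
  act_bilinear : is_bilinear act;
  act_lie : forall x y v, act (lie x y) v = act x (act y v) - act y (act x v)
}.

Section LieModules.
Variables (K : fieldType) (L : lieAlgType K).
Implicit Types V W : lieModule L.

Definition is_module_hom V W (f : V -> W) : Prop :=
  forall x v, f (act x v) = act x (f v).

Definition module_isomorphic V W : Prop :=
  exists f : {linear V -> W}, is_module_hom f /\ bijective f.

Definition is_submodule V (U : set V) : Prop :=
  is_subspace U /\ forall x v, U v -> U (act x v).

Definition generated_by V (v : V) : Prop :=
  smallest (@is_submodule V) [set v] = [set: V].

Section TensorModule.
Variables V W : lieModule L.

Definition tensor_act_pure (x : L) (v : V) (w : W) : tensor V W :=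
  tens (act x v) w + tens v (act x w).

Definition tensor_act (x : L) : tensor V W -> tensor V W :=
  tensor_lift (tensor_act_pure x).

Fact tensor_act_pure_bilinear x : is_bilinear (tensor_act_pure x).
Proof.
have bt := tens_bilinear V W; have ba := @act_bilinear _ _ V.
have ba' := @act_bilinear _ _ W.
split=> u c a b; rewrite /tensor_act_pure.
  by rewrite /= ba.2 bt.1 bt.1 /= scalerDr addrACA.
by rewrite /= ba'.2 bt.2 bt.2 /= scalerDr addrACA.
Qed.

Fact tensor_act_tens x v w :
  tensor_act x (tens v w) = tens (act x v) w + tens v (act x w).
Proof. by rewrite /tensor_act tensor_lift_tens //; apply: tensor_act_pure_bilinear. Qed.

Fact tensor_act_linear x : linear (tensor_act x).
Proof. exact/tensor_lift_linear/tensor_act_pure_bilinear. Qed.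

Fact tensor_act_bilinear : is_bilinear tensor_act.
Proof.
split=> [|x]; last exact: tensor_act_linear.
have D x t u : tensor_act x (t + u) = tensor_act x t + tensor_act x u.
  by have := tensor_act_linear x 1 t u; rewrite /= !scale1r.
have Z x : tensor_act x 0 = 0.
  by have := tensor_act_linear x (-1) 0 0; rewrite /= scaler0 addr0 scaleN1r addNr.
move=> t c x y; elim/tensor_ind: t => [|v w t IH]; first by rewrite /= !Z scaler0 addr0.
rewrite /= !D IH !tensor_act_tens (act_bilinear V).1 (act_bilinear W).1.
rewrite /= (tens_bilinear V W).1 (tens_bilinear V W).2 /= !scalerDr.
by rewrite [X in X + _ = _]addrACA [LHS]addrACA.
Qed.

Fact tensor_act_lie x y t :
  tensor_act (lie x y) t =
  tensor_act x (tensor_act y t) - tensor_act y (tensor_act x t).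
Proof.
have bta := tensor_act_bilinear; have bt := tens_bilinear V W.
elim/tensor_ind: t => [|v w t IH]; first by rewrite !(bil0r bta) subr0.
rewrite !(bilDr bta) IH opprD [RHS]addrACA; congr (_ + _).
rewrite !tensor_act_tens !(bilDr bta) !tensor_act_tens !act_lie.
rewrite (bilDl bt) (bilDr bt) (bilNl bt) (bilNr bt).
set a := tens (act x (act y v)) w; set b := tens (act y v) (act x w).
set c := tens (act x v) (act y w); set d := tens v (act x (act y w)).
set a' := tens (act y (act x v)) w; set d' := tens v (act y (act x w)).
have -> : a + b + (c + d) = a + d + (b + c) by rewrite [c + d]addrC addrACA.
have -> : a' + c + (b + d') = a' + d' + (b + c) by rewrite [b + d']addrC addrACA [c + b]addrC.
by rewrite opprD [RHS]addrACA subrr addr0 opprD [RHS]addrACA.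
Qed.

Definition tensor_module : lieModule L :=
  LieModule tensor_act_bilinear tensor_act_lie.

End TensorModule.
End LieModules.

Section SemisimpleLieAlgebra.
Variables (K : fieldType) (g : finLieAlgType K).
Implicit Types U h I : {vspace g}.

Definition lie_space U1 U2 : {vspace g} :=
  <<[seq lie x y | x <- vbasis U1, y <- vbasis U2]>>%VS.

Definition is_ideal I : Prop := forall x y, y \in I -> lie x y \in I.

Definition is_subalgebra U : Prop :=
  forall x y, x \in U -> y \in U -> lie x y \in U.

Definition is_solvable U : Prop :=
  exists k, iter k (fun U' => lie_space U' U') U = 0%VS.

Definition is_nilpotent U : Prop := exists k, iter k (lie_space U) U = 0%VS.

Definition semisimple : Prop :=
  forall I, is_ideal I -> is_solvable I -> I = 0%VS.

Definition is_cartan h : Prop :=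
  [/\ is_subalgebra h, is_nilpotent h &
      forall x, (forall y, y \in h -> lie x y \in h) -> x \in h].

Definition dual h := 'Hom(subvs_of h, K^o).

Definition root_space h (alpha : dual h) : set g :=
  [set x | forall t : subvs_of h, lie (vsval t) x = (alpha t : K) *: x].

Definition is_root h (alpha : dual h) : Prop :=
  alpha != 0 /\ exists2 x, x != 0 & root_space alpha x.

Definition nonneg_comb h r (a : 'I_r -> dual h) (beta : dual h) : Prop :=
  exists c : 'I_r -> nat, beta = \sum_i a i *+ c i.

Definition is_root_base h r (a : 'I_r -> dual h) : Prop :=
  [/\ forall i, is_root (a i), basis_of fullv [seq a i | i <- enum 'I_r] &
      forall beta, is_root beta ->
        nonneg_comb a beta \/ nonneg_comb a (- beta)].

(* A choice of Cartan subalgebra, simple roots and Chevalley generators.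
   The normalisation makes chev_h i the coroot of simple_root i. *)
Record chevalleyData := ChevalleyData {
  cartan : {vspace g};
  cartanP : is_cartan cartan;
  simple_root : 'I_(\dim cartan) -> dual cartan;
  simple_rootP : is_root_base simple_root;
  chev_e : 'I_(\dim cartan) -> g;
  chev_h : 'I_(\dim cartan) -> subvs_of cartan;
  chev_f : 'I_(\dim cartan) -> g;
  chev_eP : forall i, root_space (simple_root i) (chev_e i);
  chev_fP : forall i, root_space (- simple_root i) (chev_f i);
  chev_hE : forall i, vsval (chev_h i) = lie (chev_e i) (chev_f i);
  chev_hP : forall i, simple_root i (chev_h i) = 2%:R
}.

End SemisimpleLieAlgebra.

Arguments simple_root {K g} c i.
Arguments chev_e {K g} c i.
Arguments chev_h {K g} c i.
Arguments chev_f {K g} c i.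

Section Weights.
Variables (K : fieldType) (g : finLieAlgType K) (D : chevalleyData g).

Definition lrank : nat := \dim (cartan D).

Definition hstar := dual (cartan D).

Definition positive_root (beta : hstar) : Prop :=
  is_root beta /\ nonneg_comb (simple_root D) beta.

Definition borel_plus : set g :=
  lspan [set x | x \in cartan D \/
                 exists beta, positive_root beta /\ root_space beta x].

(* The sum of all nilpotent ideals of the Borel subalgebra, which is also
   their union because a sum of two nilpotent ideals is a nilpotent ideal. *)
Definition n_plus : set g :=
  [set x | exists I : {vspace g},
    [/\ forall y, y \in I -> borel_plus y,
        forall b y, borel_plus b -> y \in I -> lie b y \in I,
        is_nilpotent I & x \in I]].

Definition weight_lattice : set hstar :=
  [set mu | forall i, exists m : int, mu (chev_h D i) = m%:~R].

Definition weight_space (V : lieModule g) (mu : hstar) : set V :=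
  [set v | forall t : subvs_of (cartan D),
             act (vsval t) v = (mu t : K) *: v].

Definition integrable (V : lieModule g) : Prop :=
  exists S : seq hstar,
    [/\ uniq S,
        forall mu, mu \in S -> weight_lattice mu,
        forall v : V, exists2 u : hstar -> V,
          forall mu, mu \in S -> weight_space mu (u mu) &
          v = \sum_(mu <- S) u mu
      & forall u : hstar -> V,
          (forall mu, mu \in S -> weight_space mu (u mu)) ->
          \sum_(mu <- S) u mu = 0 -> forall mu, mu \in S -> u mu = 0].

Record dominantWeight := DominantWeight {
  dw_weight :> hstar;
  dw_coef : 'I_lrank -> nat;
  dw_coefP : forall i, dw_weight (chev_h D i) = (dw_coef i)%:R
}.

Fact dw_add_coefP (lam mu : dominantWeight) i :
  ((lam : hstar) + (mu : hstar)) (chev_h D i) =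
  (dw_coef lam i + dw_coef mu i)%:R.
Proof. by rewrite lfunE /= !dw_coefP natrD. Qed.

Definition dw_add (lam mu : dominantWeight) : dominantWeight :=
  DominantWeight (dw_add_coefP lam mu).

End Weights.

Arguments lrank {K g} D.
Arguments hstar {K g} D.
Arguments n_plus {K g} D.
Arguments integrable {K g} D V.

Section AffineVariety.
Variable K : fieldType.

Record affineVariety := AffineVariety {
  ambient_dim : nat;
  points :> set ('I_ambient_dim -> K);
  points_closed : exists S : set (mpoly ambient_dim K),
    points = [set x | forall p, S p -> meval x p = 0]
}.

Variable M : affineVariety.

Definition regular : {pred (set_type M -> K^o)} :=
  fun f => `[< exists p : mpoly (ambient_dim M) K,
                 forall x : set_type M, f x = meval (val x) p >].

Fact regular_subring_closed : subring_closed regular.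
Proof.
split=> [|f h|f h].
- by apply/asboolP; exists 1 => x; rewrite rmorph1.
- move=> /asboolP[p fp] /asboolP[q hq]; apply/asboolP; exists (p - q) => x.
  by rewrite rmorphB /= -fp -hq.
- move=> /asboolP[p fp] /asboolP[q hq]; apply/asboolP; exists (p * q) => x.
  by rewrite rmorphM /= -fp -hq.
Qed.

Fact regular_scaler_closed : GRing.scaler_closed regular.
Proof.
move=> c f /asboolP[p fp]; apply/asboolP; exists (c *: p) => x.
by rewrite mevalZ -fp.
Qed.

HB.instance Definition _ :=
  GRing.isSubringClosed.Build (set_type M -> K^o) regular regular_subring_closed.
HB.instance Definition _ :=
  GRing.isScaleClosed.Build K (set_type M -> K^o) regular regular_scaler_closed.

Record regfun := RegFun {
  regfun_fun :> set_type M -> K^o;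
  regfunP : regular regfun_fun
}.

HB.instance Definition _ := [isSub for regfun_fun].
HB.instance Definition _ := [Choice of regfun by <:].
HB.instance Definition _ := GRing.SubChoice_isSubComPzRing.Build
  (set_type M -> K^o) regular regfun regular_subring_closed.
HB.instance Definition _ := [SubZmodule_isSubLmodule of regfun by <:].

Lemma regfun_scaleAl (c : K) (P Q : regfun) : c *: (P * Q) = (c *: P) * Q.
Proof. by apply: val_inj; apply/funext => x /=; exact: mulrA. Qed.

Lemma regfun_scaleAr (c : K) (P Q : regfun) : c *: (P * Q) = P * (c *: Q).
Proof. by rewrite mulrC regfun_scaleAl mulrC. Qed.

End AffineVariety.

Section CurrentAlgebra.
Variables (K : fieldType) (g : lieAlgType K) (M : affineVariety K).

Definition current : Type := tensor g (regfun M).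

HB.instance Definition _ := GRing.Lmodule.on current.

Definition cur (x : g) (P : regfun M) : current := tens x P.

Fact cur_bilinear : is_bilinear cur.
Proof. exact: tens_bilinear. Qed.

Definition current_lie_pure (x : g) (P : regfun M) : current -> current :=
  tensor_lift (fun y (Q : regfun M) => cur (lie x y) (P * Q)).

(* The bracket with [x (x) P, y (x) Q] = [x, y] (x) PQ *)
Definition current_lie (s t : current) : current :=
  tensor_lift (fun x P => current_lie_pure x P t) s.

Fact current_lie_inner_bilinear x (P : regfun M) :
  is_bilinear (fun y (Q : regfun M) => cur (lie x y) (P * Q)).
Proof.
split=> [Q|y] c a b /=.
  by rewrite (lie_bilinear.2) cur_bilinear.1.
by rewrite mulrDr -regfun_scaleAr cur_bilinear.2.
Qed.

Fact current_lie_pure_linear x P : linear (current_lie_pure x P).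
Proof. exact/tensor_lift_linear/current_lie_inner_bilinear. Qed.

Fact current_lie_pure_cur x P y (Q : regfun M) :
  current_lie_pure x P (cur y Q) = cur (lie x y) (P * Q).
Proof. by rewrite /current_lie_pure tensor_lift_tens //; exact: current_lie_inner_bilinear. Qed.

Lemma current_ind (P : current -> Prop) :
  P 0 -> (forall x Q s, P s -> P (cur x Q + s)) -> forall s, P s.
Proof. exact: tensor_ind. Qed.

Fact current_lie_outer_bilinear t :
  is_bilinear (fun x P => current_lie_pure x P t).
Proof.
have D x P a b : current_lie_pure x P (a + b) =
    current_lie_pure x P a + current_lie_pure x P b.
  by have := current_lie_pure_linear x P 1 a b; rewrite /= !scale1r.
have Z x P : current_lie_pure x P 0 = 0.
  have := current_lie_pure_linear x P (-1) 0 0.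
  by rewrite /= scaler0 addr0 scaleN1r addNr.
split=> [P|x] c a b /=; elim/current_ind: t => [|y Q t IH].
- by rewrite !Z scaler0 addr0.
- rewrite !D IH !current_lie_pure_cur (lie_bilinear.1) /= cur_bilinear.1 /=.
  by rewrite scalerDr addrACA.
- by rewrite !Z scaler0 addr0.
- rewrite !D IH !current_lie_pure_cur mulrDl -regfun_scaleAl cur_bilinear.2 /=.
  by rewrite scalerDr addrACA.
Qed.

Fact current_lie_curl x P t : current_lie (cur x P) t = current_lie_pure x P t.
Proof. by rewrite /current_lie tensor_lift_tens //; exact: current_lie_outer_bilinear. Qed.

Lemma current_lie_cur x (P : regfun M) y (Q : regfun M) :
  current_lie (cur x P) (cur y Q) = cur (lie x y) (P * Q).
Proof. by rewrite current_lie_curl current_lie_pure_cur. Qed.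

Fact current_lie_bilinear : is_bilinear current_lie.
Proof.
have L t : linear (current_lie^~ t).
  exact/tensor_lift_linear/current_lie_outer_bilinear.
split=> [//|s] c a b; elim/current_ind: s => [|x P s IH].
  have Z t : current_lie 0 t = 0.
    by have := L t (-1) 0 0; rewrite /= scaler0 addr0 scaleN1r addNr.
  by rewrite /= !Z scaler0 addr0.
have D t p q : current_lie (p + q) t = current_lie p t + current_lie q t.
  by have := L t 1 p q; rewrite /= !scale1r.
rewrite /= !D IH !current_lie_curl current_lie_pure_linear /=.
by rewrite scalerDr addrACA.
Qed.

Let bl := current_lie_bilinear.

Fact current_lieC s t : current_lie s t = - current_lie t s.
Proof.
elim/current_ind: s t => [|x P s IH] t.
  by rewrite (bil0l bl) (bil0r bl) oppr0.
rewrite (bilDl bl) (bilDr bl) IH opprD; congr (_ + _).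
elim/current_ind: t => [|y Q t IHt]; first by rewrite (bil0l bl) (bil0r bl) oppr0.
rewrite (bilDl bl) (bilDr bl) IHt opprD; congr (_ + _).
by rewrite !current_lie_cur lieC (bilNl cur_bilinear) mulrC.
Qed.

Fact current_liexx s : current_lie s s = 0.
Proof.
elim/current_ind: s => [|x P s IH]; first exact: (bil0l bl).
rewrite (bilDl bl) !(bilDr bl) IH addr0 current_lie_cur liexx.
by rewrite (bil0l cur_bilinear) add0r [current_lie s _]current_lieC subrr.
Qed.

Fact current_jacobi s t u :
  current_lie s (current_lie t u) + current_lie t (current_lie u s) +
  current_lie u (current_lie s t) = 0.
Proof.
pose J s t u := current_lie s (current_lie t u) +
  current_lie t (current_lie u s) + current_lie u (current_lie s t).
have Jrot a b c : J a b c = J b c a by rewrite /J addrAC [RHS]addrC addrA addrAC.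
have JD a b c d : J (a + b) c d = J a c d + J b c d.
  rewrite /J !(bilDl bl) !(bilDr bl).
  by rewrite [RHS]addrACA [X in _ = X + _]addrACA.
have J0 c d : J 0 c d = 0.
  by rewrite /J (bil0l bl) !(bil0r bl) (bil0l bl) (bil0r bl) !addr0.
rewrite -/(J s t u).
elim/current_ind: s => [|x P s IH]; first exact: J0.
rewrite JD IH addr0 Jrot => {s IH}.
elim/current_ind: t => [|y Q t IH]; first exact: J0.
rewrite JD IH addr0 Jrot => {t IH}.
elim/current_ind: u => [|z R u IH]; first exact: J0.
rewrite JD IH addr0 /J !current_lie_cur => {u IH}.
have -> : P * (Q * R) = R * (P * Q) by rewrite mulrA mulrC.
have -> : Q * (R * P) = R * (P * Q) by rewrite mulrCA [Q * P]mulrC.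
by rewrite -!(bilDl cur_bilinear) lie_jacobi (bil0l cur_bilinear).
Qed.

HB.instance Definition _ := isLieAlgebra.Build K current
  current_lie_bilinear current_liexx current_jacobi.

Lemma lie_cur (x y : g) (P Q : regfun M) :
  lie (cur x P) (cur y Q) = cur (lie x y) (P * Q).
Proof. exact: current_lie_cur. Qed.

Section Restriction.
Variable N : lieModule current.

Definition restr_act (x : g) (v : N) : N := act (cur x 1) v.

Fact restr_act_bilinear : is_bilinear restr_act.
Proof.
split=> [v|x] c a b /=; rewrite /restr_act.
  by rewrite cur_bilinear.1 (act_bilinear N).1.
exact: (act_bilinear N).2.
Qed.

Fact restr_act_lie x y v :
  restr_act (lie x y) v = restr_act x (restr_act y v) - restr_act y (restr_act x v).
Proof. by rewrite /restr_act -act_lie lie_cur mulr1. Qed.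

(* Restriction along g = g (x) 1 *)
Definition restr_module : lieModule g :=
  LieModule restr_act_bilinear restr_act_lie.

End Restriction.
End CurrentAlgebra.

Section WeylModules.
Variables (K : fieldType) (g : finLieAlgType K) (D : chevalleyData g).
Variable M : affineVariety K.

(* Z i lists the points Z^(i)_j, j = 1, ..., lambda_i; the order plays no role
   below. *)
Definition multiset (lam : dominantWeight D) : Type :=
  forall i : 'I_(lrank D), (dw_coef lam i).-tuple (set_type M).

Definition multiset_union (lam lam' : dominantWeight D)
    (Z : multiset lam) (Z' : multiset lam') : multiset (dw_add lam lam') :=
  fun i => cat_tuple (Z i) (Z' i).

Variables (lam : dominantWeight D) (Z : multiset lam).

Definition weyl_cyclic (N : lieModule (current g M)) (v : N) : Prop :=
  [/\ integrable D (restr_module N),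
      generated_by v,
      forall x (P : regfun M), n_plus D x -> act (cur x P) v = 0 &
      forall (P : regfun M) i,
        act (cur (vsval (chev_h D i)) P) v =
        (\sum_(j < dw_coef lam i) P (tnth (Z i) j)) *: v].

(* W is maximal among the modules satisfying weyl_cyclic: any other one is its
   quotient, generator going to generator. *)
Definition is_local_weyl (W : lieModule (current g M)) (w : W) : Prop :=
  weyl_cyclic w /\
  forall (N : lieModule (current g M)) (v : N), weyl_cyclic v ->
    exists f : {linear W -> N},
      [/\ is_module_hom f, f w = v & forall y, exists x, f x = y].

End WeylModules.

(* Main.v *)
Require Import Defs.
From HB Require Import structures.
From mathcomp Require Import all_boot all_order all_algebra.
From mathcomp Require Import spectral mxred.
From mathcomp Require Import boolp classical_sets functions reals complex.
From mathcomp Require Import ring zify.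

Set Implicit Arguments.
Unset Strict Implicit.
Unset Printing Implicit Defensive.

Import Order.TTheory GRing.Theory Num.Theory VectorInternalTheory.
Local Open Scope ring_scope.

(** The theorem reduces to the fact that a local Weyl module only sees a power
    of the ideal of functions vanishing on its multiset, after which the Chinese
    remainder theorem applies.

    Nilpotency.  Let v generate an integrable module N, be killed by
    n_+ (x) A, and satisfy (h_i (x) Q) v = chi_i(Q) v, and let P be a function
    with chi_i(P Q) = 0 for all i and Q, for instance one vanishing on the
    multiset.  Then g (x) P^k A kills N for some k (power_annihilates).  As the
    module has finitely many weights, (f_i (x) P)^(n+1) v = 0 for some n.
    Applying e_i (x) 1 to a product of operators f_i (x) P^a on v replaces, up to
    the factor -2, the product by the sum of all products in which two factors
    f_i (x) P^a, f_i (x) P^b are merged into f_i (x) P^(a+b), since the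
    h_i (x) P^a with a > 0 kill v; after n steps one gets a nonzero multiple of
    (f_i (x) P^(n+1)) v (lowering_power).  The x in g such that x (x) P^k A kills
    v for some k form a subalgebra, which thus contains h, the e_i and the
    f_i, and so is g; and the vectors killed by g (x) P^k A form a
    submodule.

    Structure of g.  This uses that h and the Chevalley generators generate g
    (stable_full), that the coroots span h (chev_h_span) and that the e_i lie in
    n_+ (n_plus_root_vector).  All of it is derived from the definition of the
    Chevalley data.  The algebra h is abelian because the simple roots separate
    its points.  By sl2-theory the coroots have integral eigenvalues on g and on
    its sl2-stable quotients, so the Killing form is a sum of squares on their
    real span; with the identity kappa(h_i, t) = alpha_i(t) kappa(e_i, f_i) it
    shows that the coroots are independent, and that a nonzero combination of
    simple roots with natural coefficients is positive on some coroot of its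
    support (root_comb_positive).  Now if a proper subspace S contained h and
    were stable under h and the e_i and f_i, the quotient g / S would have a
    weight, which is plus or minus such a combination; by the positivity one could
    subtract (or add) simple roots one at a time, staying within the weights of
    g / S, and reach the weight zero.  But zero is not a weight of g / S, as the
    weight space of zero is h, which S contains.

    The isomorphism.  Interpolation gives P equal to 0 on Z and to 1 on Z'.  Some
    polynomial p in P is divisible by P^k, has 1 - p divisible by (1 - P)^k,
    and hence acts as an idempotent on the three modules involved
    (separating_function).  On W1 (x) W2 the element x (x) (1 - p) Q
    acts through the first factor and x (x) p Q through the second one, so that
    this module is generated by w1 (x) w2 and is a quotient of W.  Conversely,
    the submodule generated by w in W, twisted so that x (x) Q acts as
    x (x) (1 - p) Q, satisfies the conditions defining W1, and likewise with p
    for W2 (twisted_hom).  The two twisted actions on W commute, so that the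
    resulting maps from W1 and W2 to W combine into a bilinear map, that is, a
    homomorphism from W1 (x) W2 to W taking w1 (x) w2 to w.  Both composites fix
    generators, hence are identities. *)

(** * Subspaces *)

Section Subspace.
Variables (K : fieldType) (V : lmodType K) (U : set V).
Hypothesis sU : is_subspace U.

Lemma subspace0 : U 0. Proof. exact: sU.1. Qed.
Lemma subspaceD x y : U x -> U y -> U (x + y).
Proof. by move=> Ux Uy; rewrite -[x]scale1r; apply: sU.2. Qed.
Lemma subspaceZ c x : U x -> U (c *: x).
Proof. by move=> Ux; rewrite -[_ *: _]addr0; apply: sU.2 => //; exact: subspace0. Qed.
Lemma subspaceB x y : U x -> U y -> U (x - y).
Proof. by move=> Ux Uy; rewrite -scaleN1r; apply: subspaceD => //; apply: subspaceZ. Qed.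
Lemma subspace_sum (I : Type) (s : seq I) (P : pred I) (F : I -> V) :
  (forall i, P i -> U (F i)) -> U (\sum_(i <- s | P i) F i).
Proof. by move=> UF; elim/big_ind: _ => //; [exact: subspace0 | exact: subspaceD]. Qed.
Lemma subspaceZE c x : c != 0 -> U (c *: x) -> U x.
Proof. by move=> c0 /(subspaceZ c^-1); rewrite scalerA mulVf // scale1r. Qed.
Lemma subspaceDl x y : U x -> U (x + y) -> U y.
Proof. by move=> Ux Uxy; rewrite -[y](addKr x) addrC; apply: subspaceB. Qed.
End Subspace.

Lemma zero_subspace (K : fieldType) (V : lmodType K) :
  is_subspace [set (0 : V)]%classic.
Proof. by split=> // c x y -> ->; rewrite scaler0 addr0. Qed.

Lemma vspace_subspace (K : fieldType) (V : vectType K) (U : {vspace V}) :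
  is_subspace [set x | x \in U]%classic.
Proof. by split=> [|c x y Ux Uy]; rewrite /= ?mem0v // memvD ?memvZ. Qed.

(** Every subspace given as a set of vectors of a finite-dimensional space is
    a detachable subspace: take one of maximal dimension contained in it. *)
Lemma subspace_vspace (K : fieldType) (V : vectType K) (U : set V) :
  is_subspace U -> exists I : {vspace V}, forall x, x \in I <-> U x.
Proof.
move=> sU.
pose P n := `[< exists I : {vspace V}, \dim I = n /\ forall x, x \in I -> U x >].
have P0 : exists n, P n.
  exists 0%N; apply/asboolP; exists 0%VS; rewrite dimv0; split=> // x.
  by rewrite memv0 => /eqP->; exact: subspace0.
have Pm n : P n -> (n <= \dim {:V})%N.
  by move=> /asboolP[I [<- _]]; exact: dimvS (subvf I).
case: (ex_maxnP P0 Pm) => n /asboolP[I [dI UI]] maxn.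
exists I => x; split=> [|Ux]; first exact: UI.
have : P (\dim (I + <[x]>)%VS).
  apply/asboolP; exists (I + <[x]>)%VS; split=> // y /memv_addP[u uI [w]].
  move=> /vlineP[k ->] ->; apply: subspaceD => //; first exact: UI.
  exact: subspaceZ.
move=> /maxn; rewrite -dI => le.
have /eqP -> : I == (I + <[x]>)%VS by rewrite eqEdim addvSl.
by rewrite (subvP (addvSr I <[x]>)) ?memv_line.
Qed.

(** * Eigenvectors modulo a subspace *)

Section EigenModulo.
Variables (K : closedFieldType) (V : vectType K).

Lemma linD (T : {linear V -> V}) x y : T (x + y) = T x + T y.
Proof. exact: linearD. Qed.
Lemma linB (T : {linear V -> V}) x y : T (x - y) = T x - T y.
Proof. exact: linearB. Qed.
Lemma linZ (T : {linear V -> V}) c x : T (c *: x) = c *: T x.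
Proof. exact: linearZ. Qed.

(** The composite of the operators T - a, for a in the list l. *)
Definition shifts (T : V -> V) (l : seq K) (x : V) : V :=
  foldr (fun a y => T y - a *: y) x l.

Lemma shifts_cat T l1 l2 x : shifts T (l1 ++ l2) x = shifts T l1 (shifts T l2 x).
Proof. exact: foldr_cat. Qed.

Section OneOperator.
Variable T : {linear V -> V}.

Lemma shiftsD l x y : shifts T l (x + y) = shifts T l x + shifts T l y.
Proof. by elim: l => //= a l ->; rewrite linD scalerDr opprD addrACA. Qed.

Lemma shiftsZ l c x : shifts T l (c *: x) = c *: shifts T l x.
Proof. by elim: l => //= a l ->; rewrite linZ scalerBr !scalerA mulrC. Qed.

Lemma shifts_comm1 (T' : {linear V -> V}) : (forall x, T (T' x) = T' (T x)) ->
  forall l x, shifts T l (T' x) = T' (shifts T l x).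
Proof. by move=> cT l x; elim: l => //= a l IH; rewrite IH linB linZ cT. Qed.

Lemma shifts_perm l1 l2 x : perm_eq l1 l2 -> shifts T l1 x = shifts T l2 x.
Proof.
have comm s t y : shifts T s (shifts T t y) = shifts T t (shifts T s y).
  elim: t y => //= a t IH y; rewrite -IH shiftsD shifts_comm1 //.
  by rewrite -!scaleNr shiftsZ.
move=> p; apply: (@catCA_perm_ind _ (fun l => shifts T l1 x = shifts T l x) _ _ _ p) => //.
move=> s1 s2 s3 ->; rewrite !shifts_cat comm //.
Qed.

Lemma shifts_subspace (U : set V) l x : is_subspace U ->
  (forall y, U y -> U (T y)) -> U x -> U (shifts T l x).
Proof.
move=> sU UT Ux; elim: l => //= a l IH.
by apply: (subspaceB sU); [exact: UT|exact: subspaceZ].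
Qed.

Lemma shifts_eigen (S : set V) l c x : is_subspace S ->
  (forall y, S y -> S (T y)) -> S (T x - c *: x) ->
  S (shifts T l x - (\prod_(a <- l) (c - a)) *: x).
Proof.
move=> sS ST Sx; elim: l => [|a l IH] /=.
  by rewrite big_nil scale1r subrr; exact: subspace0.
rewrite big_cons; set p := \prod_(_ <- _) _ in IH *; set y := shifts T l x in IH *.
have -> : T y - a *: y - ((c - a) * p) *: x =
   T (y - p *: x) + (p *: (T x - c *: x) - a *: (y - p *: x)).
  rewrite linB linZ !scalerBr !scalerA mulrBl scalerBl [p * c]mulrC.
  rewrite -!addrA addKr; congr (_ + _).
  by rewrite !opprB addrCA [RHS]addrCA; congr (_ + _); rewrite addrC.
apply: (subspaceD sS); first exact: ST.
by apply: (subspaceB sS); apply: subspaceZ.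
Qed.

Lemma annihilating_shifts : exists l, forall x, shifts T l x = 0.
Proof.
have [n [f [f' [fl fK f'K]]]] : exists n, exists f : V -> 'rV[K]_n,
    exists f' : {linear 'rV[K]_n -> V}, [/\ linear f, cancel f f' & cancel f' f].
  exists _, v2r, r2v; split; [exact: linearP | exact: v2rK | exact: r2vK].
pose A : 'M[K]_n := \matrix_i f (T (f' (delta_mx 0 i))).
have fl0 : f 0 = 0 by have := fl (-1) 0 0; rewrite scaler0 addr0 scaleN1r addNr.
have fD x y : f (x + y) = f x + f y by have := fl 1 x y; rewrite !scale1r.
have fZ c x : f (c *: x) = c *: f x by have := fl c x 0; rewrite !addr0 fl0 addr0.
have fA x : f (T x) = f x *m A.
  rewrite -{1}[x]fK mulmx_sum_row {1}(row_sum_delta (f x)) !linear_sum /=.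
  rewrite (big_morph f fD fl0); apply: eq_bigr => i _.
  by rewrite !linearZ /= fZ rowK.
suff [l lP] : exists l : seq K,
    forall u : 'rV_n, foldr (fun a w => w *m A - a *: w) u l = 0.
  exists l => x; apply: (can_inj fK); rewrite fl0 -[RHS](lP (f x)).
  elim: l {lP} => //= a l IH; rewrite -IH fD fA -scaleNr fZ scaleNr //.
move: (A) => B; clear -B; case: n B => [|n] A.
  by exists [::] => u; rewrite [u]thinmx0.
have [l Dl] := closed_field_poly_normal (char_poly A).
exists l => u.
have -> : foldr (fun a w => w *m A - a *: w) u l =
    u *m horner_mx A (\prod_(a <- l) ('X - a%:P)).
  elim: l {Dl} => [|a l IH]; first by rewrite big_nil rmorph1 mulmx1.
  rewrite /= big_cons IH mulrC rmorphM /= rmorphB /= horner_mx_X horner_mx_C.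
  by rewrite -mulmxE mulmxBr mulmxBr mul_mx_scalar scalemxAr mulmxA -scalemxAr.
have := Cayley_Hamilton A; rewrite Dl.
by rewrite (monicP (char_poly_monic A)) scale1r => ->; rewrite mulmx0.
Qed.

(** Only finitely many scalars are eigenvalues of T modulo a stable subspace. *)
Lemma finite_spectrum : exists l : seq K, forall (S : set V) c x,
  is_subspace S -> (forall y, S y -> S (T y)) ->
  ~ S x -> S (T x - c *: x) -> c \in l.
Proof.
have [l lP] := annihilating_shifts; exists l => S c x sS ST nSx Sx.
have := shifts_eigen l sS ST Sx; rewrite lP sub0r -scaleNr.
move=> Sp; apply: contrapT => /negP cl; apply: nSx; apply: (subspaceZE sS _ Sp).
rewrite oppr_eq0 prodf_seq_neq0; apply/allP => a al; rewrite /= subr_eq0.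
by apply: contraNneq cl => ->.
Qed.

(** A partial product of the annihilating T - a yields an eigenvector modulo S;
    applying the factors with a different from its eigenvalue then makes it a
    generalized eigenvector without moving it into S. *)
Lemma generalized_eigenvector (S : set V) x : is_subspace S ->
  (forall y, S y -> S (T y)) -> ~ S x ->
  exists a l m, let y := shifts T l x in
    [/\ ~ S y, S (T y - a *: y) & shifts T (nseq m a) y = 0].
Proof.
move=> sS ST nSx; have [l lP] := annihilating_shifts.
have [a [l1 [nS1 S1]]] : exists a l1, ~ S (shifts T l1 x) /\
    S (T (shifts T l1 x) - a *: shifts T l1 x).
  have : S (shifts T l x) by rewrite lP; exact: subspace0.
  elim: l {lP} => [|a l IH] //= Sl.
  by have [/IH//|nS] := pselect (S (shifts T l x)); exists a, l.
pose l2 := [seq b <- l | b != a].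
exists a, (l2 ++ l1), (count_mem a l); rewrite /= shifts_cat.
set x1 := shifts T l1 x in nS1 S1 *.
have STl y : S y -> S (shifts T l2 y) by move=> Sy; exact: shifts_subspace.
split.
- move=> S2; have := shifts_eigen l2 sS ST S1 => S3.
  apply: nS1; have : S ((\prod_(b <- l2) (a - b)) *: x1).
    by have := subspaceB sS S2 S3; rewrite opprB addrCA subrr addr0.
  apply: (subspaceZE sS); rewrite prodf_seq_neq0; apply/allP => b.
  by rewrite mem_filter /= => /andP[ba _]; rewrite subr_eq0 eq_sym.
- have -> : T (shifts T l2 x1) - a *: shifts T l2 x1 =
      shifts T l2 (T x1 - a *: x1).
    by rewrite shiftsD -!scaleNr shiftsZ shifts_comm1.
  exact: STl.
- rewrite -shifts_cat (shifts_perm (l2 := l)) ?lP //.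
  have -> : nseq (count_mem a l) a = filter (pred1 a) l.
    have /all_pred1P -> := filter_all (pred1 a) l; by rewrite size_filter.
  by rewrite perm_filterC.
Qed.

End OneOperator.

Lemma joint_eigenvector_seq (I : eqType) (T : I -> {linear V -> V}) (s : seq I) :
  (forall i j x, T i (T j x) = T j (T i x)) ->
  forall (S U : set V) x, is_subspace S -> (forall i y, S y -> S (T i y)) ->
  is_subspace U -> (forall i y, U y -> U (T i y)) -> ~ S x -> U x ->
  exists y, [/\ ~ S y, U y & forall i, i \in s -> exists a m,
    S (T i y - a *: y) /\ shifts (T i) (nseq m a) y = 0].
Proof.
move=> cT; elim: s => [|i s IH] S U x sS ST sU UT nSx Ux; first by exists x.
have [a [l [m /=]]] := generalized_eigenvector sS (ST i) nSx.
set x1 := shifts _ l x => -[nSx1 Sx1 x1m].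
have Ux1 : U x1 by apply: shifts_subspace (UT i) Ux.
pose U' : set V := [set y | [/\ U y, S (T i y - a *: y) &
  shifts (T i) (nseq m a) y = 0]]%classic.
have [] := IH S U' x1 sS ST _ _ nSx1 _.
- split=> [|c y z [Uy Sy y0] [Uz Sz z0]].
    split; first exact: subspace0.
      by rewrite linear0 scaler0 subrr; exact: subspace0.
    by have := shiftsZ (T i) (nseq m a) 0 0; rewrite !scale0r.
  split; first by apply: subspaceD => //; exact: subspaceZ.
    rewrite linD linZ scalerDr scalerA mulrC -scalerA opprD addrACA -scalerBr.
    by apply: subspaceD => //; exact: subspaceZ.
  by rewrite shiftsD shiftsZ y0 z0 scaler0 addr0.
- move=> j y [Uy Sy y0]; split; first exact: UT.
    by rewrite cT -linZ -linB; exact: ST.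
  by rewrite (@shifts_comm1 (T i) (T j)) ?y0 ?linear0.
- by [].
move=> y [nSy [Uy Sy y0] yP]; exists y; split=> // j.
by rewrite inE => /predU1P[->|/yP//]; exists a, m.
Qed.

(** There is a vector outside S which is a joint eigenvector modulo S of a
    commuting family, and a joint generalized eigenvector, in V itself, for the
    same eigenvalues. *)
Lemma joint_eigenvector (I : finType) (T : I -> {linear V -> V}) (S U : set V) x :
  (forall i j x, T i (T j x) = T j (T i x)) ->
  is_subspace S -> (forall i y, S y -> S (T i y)) ->
  is_subspace U -> (forall i y, U y -> U (T i y)) -> ~ S x -> U x ->
  exists y (a : I -> K) (m : I -> nat), [/\ ~ S y, U y &
    forall i, S (T i y - a i *: y) /\ shifts (T i) (nseq (m i) (a i)) y = 0].
Proof.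
move=> cT sS ST sU UT nSx Ux.
have [y [nSy Uy yP]] :=
  @joint_eigenvector_seq I T (enum I) cT S U x sS ST sU UT nSx Ux.
have /choice[f fP] : forall i, exists p : K * nat,
    S (T i y - p.1 *: y) /\ shifts (T i) (nseq p.2 p.1) y = 0.
  by move=> i; have [|a [m am]] := yP i; [rewrite mem_enum | exists (a, m)].
by exists y, (fst \o f), (snd \o f).
Qed.

Lemma generalized_eigenvalue_unique (T : {linear V -> V}) (S : set V) m a b y :
  is_subspace S -> (forall y, S y -> S (T y)) ->
  ~ S y -> S (T y - b *: y) -> S (shifts T (nseq m a) y) -> b = a.
Proof.
move=> sS ST nSy Sy Sm; apply/eqP; rewrite -subr_eq0.
apply: contra_notT nSy => ab; have := shifts_eigen (nseq m a) sS ST Sy.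
move=> /(subspaceB sS Sm); rewrite opprB addrCA subrr addr0.
move/(subspaceZE sS); apply; rewrite prodf_seq_neq0.
by apply/allP => c /nseqP[->].
Qed.

(** A joint generalized eigenspace not contained in S contains a joint
    eigenvector modulo S with the same eigenvalues. *)
Lemma generalized_eigenspace_eigenvector (I : finType) (T : I -> {linear V -> V})
    (S : set V) (a : I -> K) (m : I -> nat) x :
  (forall i j x, T i (T j x) = T j (T i x)) ->
  is_subspace S -> (forall i y, S y -> S (T i y)) -> ~ S x ->
  (forall i, shifts (T i) (nseq (m i) (a i)) x = 0) ->
  exists2 y, ~ S y & forall i, S (T i y - a i *: y).
Proof.
move=> cT sS ST nSx xm.
pose U : set V := [set y | forall i, shifts (T i) (nseq (m i) (a i)) y = 0]%classic.
have [] := @joint_eigenvector I T S U x cT sS ST _ _ nSx xm.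
- split=> [i|c y z y0 z0 i].
    by have := shiftsZ (T i) (nseq (m i) (a i)) 0 0; rewrite !scale0r.
  by rewrite shiftsD shiftsZ y0 z0 scaler0 addr0.
- by move=> i y y0 j; rewrite (@shifts_comm1 (T j) (T i)) ?y0 ?linear0.
move=> y [b [n [nSy Uy yP]]]; exists y => // i.
have Sm : S (shifts (T i) (nseq (m i) (a i)) y).
  by rewrite (Uy i); exact: subspace0.
rewrite -(generalized_eigenvalue_unique sS (ST i) nSy (yP i).1 Sm).
exact: (yP i).1.
Qed.
End EigenModulo.

(** * Modules over sl2 *)

Section Sl2.
Variables (K : numClosedFieldType) (V : vectType K) (E H F : {linear V -> V}).
Hypothesis EF : forall x, E (F x) - F (E x) = H x.
Hypothesis HE : forall x, H (E x) - E (H x) = 2 *: E x.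
Hypothesis HF : forall x, H (F x) - F (H x) = - 2 *: F x.
Variable S : set V.
Hypothesis sS : is_subspace S.
Hypotheses (SE : forall x, S x -> S (E x)) (SH : forall x, S x -> S (H x))
  (SF : forall x, S x -> S (F x)).

Lemma arith_progression_leaves (l : seq K) (c d : K) : d != 0 ->
  exists n, c + d *+ n \notin l.
Proof.
move=> d0; apply: contrapT => nex.
pose s := [seq c + d *+ n | n <- iota 0 (size l).+1].
have us : uniq s.
  rewrite map_inj_uniq ?iota_uniq // => m n /addrI /eqP.
  by rewrite -(mulr_natr d m) -(mulr_natr d n) (inj_eq (mulfI d0)) eqr_nat => /eqP.
have /(uniq_leq_size us) : {subset s <= l}.
  move=> _ /mapP[n _ ->]; apply: contrapT => /negP nl.
  by apply: nex; exists n.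
by rewrite size_map size_iota ltnn.
Qed.

Lemma sl2_E_weight c x n : S (H x - c *: x) ->
  S (H (iter n E x) - (c + 2 *+ n) *: iter n E x).
Proof.
move=> Sx; elim: n => [|n IH] /=; first by rewrite addr0.
have := SE IH; rewrite linB linZ.
have -> : E (H (iter n E x)) = H (E (iter n E x)) - 2 *: E (iter n E x).
  by rewrite -HE opprB addrC subrK.
by rewrite (mulrS _ n) addrCA [(2 + _) *: _]scalerDl opprD addrA.
Qed.

Lemma sl2_F_weight c x n : S (H x - c *: x) ->
  S (H (iter n F x) - (c - 2 *+ n) *: iter n F x).
Proof.
move=> Sx; elim: n => [|n IH] /=; first by rewrite subr0.
have := SF IH; rewrite linB linZ.
have -> : F (H (iter n F x)) = H (F (iter n F x)) - (- 2) *: F (iter n F x).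
  by rewrite -HF opprB addrC subrK.
rewrite (_ : c - 2 *+ n.+1 = - 2 + (c - 2 *+ n)); last first.
  by rewrite (mulrS _ n) opprD addrCA.
by rewrite [(- 2 + _) *: _]scalerDl [- (_ + _ *: _)]opprD addrA.
Qed.

Lemma sl2_EF_iter c x n : S (H x - c *: x) -> S (E x) ->
  S (E (iter n.+1 F x) - (n.+1%:R * (c - n%:R)) *: iter n F x).
Proof.
move=> Sx SEx; elim: n => [|n IH].
  rewrite /= mul1r subr0; have -> : E (F x) = H x + F (E x) by rewrite -EF subrK.
  by rewrite addrAC; apply: (subspaceD sS) => //; exact: SF.
have -> : E (iter n.+2 F x) = H (iter n.+1 F x) + F (E (iter n.+1 F x)).
  by rewrite -EF subrK.
have := subspaceD sS (sl2_F_weight n.+1 Sx) (SF IH).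
rewrite (linB F) (linZ F) -iterS addrACA -opprD -scalerDl.
congr (S (_ - _ *: _)); rewrite -mulr_natr -!natr1; ring.
Qed.

(** Primitive vectors of a finite-dimensional sl2-module have weight in the
    natural numbers; this is stated for the quotient by a submodule S. *)
Lemma sl2_highest_weight c x :
  ~ S x -> S (H x - c *: x) -> S (E x) -> exists n : nat, c = n%:R.
Proof.
move=> nSx Sx SEx; apply: contrapT => nat_c.
have nS n : ~ S (iter n F x).
  elim: n => // n IH Sn; apply: IH; have := sl2_EF_iter n Sx SEx.
  move/(subspaceB sS (SE Sn)); rewrite opprB addrCA subrr addr0.
  move/(subspaceZE sS); apply; rewrite mulf_neq0 ?pnatr_eq0 // subr_eq0.
  by apply/eqP => cn; apply: nat_c; exists n.
have [l lP] := finite_spectrum H.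
have [|n] := @arith_progression_leaves l c (- 2); first by rewrite oppr_eq0 pnatr_eq0.
move=> /negP; apply; rewrite mulNrn.
apply: (lP S _ (iter n F x)) => //; exact: sl2_F_weight.
Qed.

Lemma sl2_weight_int c x : ~ S x -> S (H x - c *: x) -> exists z : int, c = z%:~R.
Proof.
move=> nSx Sx; have [l lP] := finite_spectrum H.
have [n [nSn SEn]] : exists n, ~ S (iter n E x) /\ S (E (iter n E x)).
  apply: contrapT => nex.
  have nS n : ~ S (iter n E x).
    by elim: n => // n IH Sn; apply: nex; exists n.
  have [|n] := @arith_progression_leaves l c 2; first by rewrite pnatr_eq0.
  move=> /negP; apply; apply: (lP S _ (iter n E x)) => //; exact: sl2_E_weight.
have [m cm] := sl2_highest_weight nSn (sl2_E_weight n Sx) SEn.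
exists (m%:Z - 2 *+ n); apply/eqP; rewrite rmorphB /= rmorphMn /= -subr_eq0.
by rewrite opprB addrA -[c + _](_ : m%:R = _) ?subrr // -cm.
Qed.
End Sl2.

(** * Simultaneous triangularization and traces *)

Lemma trace_mul_trig (K : fieldType) n (A B : 'M[K]_n) :
  is_trig_mx A -> is_trig_mx B -> \tr (A *m B) = \sum_k A k k * B k k.
Proof.
move=> /is_trig_mxP tA /is_trig_mxP tB; apply: eq_bigr => k _.
rewrite mxE (bigD1 k) //= big1 ?addr0 // => j /negP jk.
have [lt_kj|lt_jk|/val_inj e] := ltngtP k j.
- by rewrite tA // mul0r.
- by rewrite tB // mulr0.
- by case: jk; rewrite e.
Qed.

Lemma commuting_trace_products (K : numClosedFieldType) n (I : finType)
    (A : I -> 'M[K]_n) : (forall i j, A i *m A j = A j *m A i) ->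
  exists d : I -> 'I_n -> K,
    (forall i c, eigenvalue (A i) c <-> exists k, c = d i k) /\
    forall i j, \tr (A i *m A j) = \sum_k d i k * d j k.
Proof.
move=> cA; have [] := @cotrigonalization K n [seq A i | i <- enum I].
  by move=> _ _ /mapP[i _ ->] /mapP[j _ ->]; exact: cA.
move=> P Pu /allP Atrig; have {}Pu : P \in unitmx by exact: unitarymx_unit.
pose B i := P *m A i *m invmx P.
have Btrig i : is_trig_mx (B i).
  by have := Atrig (A i) (map_f A (mem_enum I i)); rewrite /= /similar_to /= conjumx.
exists (fun i k => B i k k); split=> [i c|i j]; last first.
  rewrite -trace_mul_trig // /B !mulmxA mulmxKV //.
  by rewrite [RHS]mxtrace_mulC !mulmxA mulVmx // mul1mx.
have -> : eigenvalue (A i) c = eigenvalue (B i) c.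
  apply/eigenvalueP/eigenvalueP => -[v vA v0].
    exists (v *m invmx P); first by rewrite /B !mulmxA mulmxKV // vA scalemxAl.
    by apply: contraNneq v0 => vP; rewrite -[v](mulmxKV Pu) vP mul0mx.
  exists (v *m P).
    by rewrite -[LHS](mulmxKV Pu) scalemxAl -vA /B !mulmxA.
  by apply: contraNneq v0 => vP; rewrite -[v](mulmxK Pu) vP mul0mx.
rewrite eigenvalue_root_char char_poly_trig //.
rewrite -(big_map (fun k => B i k k) xpredT (fun a => 'X - a%:P)) root_prod_XsubC.
split=> [/mapP[k _ ->]|[k ->]]; first by exists k.
by apply/mapP; exists k; rewrite ?mem_index_enum.
Qed.

(** * The Killing form *)

Lemma injective_surjective (K : fieldType) (U V : vectType K)
    (f : {linear U -> V}) : dim U = dim V ->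
  (forall u, f u = 0 -> u = 0) -> forall v, exists u, f u = v.
Proof.
move=> dUV inj0 v; pose F := linfun f.
have kF : lker F == 0%VS.
  apply/lker0P => x y; rewrite !lfunE => fxy; apply/eqP.
  by rewrite -subr_eq0; apply/eqP/inj0; rewrite linearB /= fxy subrr.
have : v \in limg F.
  rewrite (_ : limg F = fullv) ?memvf //; apply/eqP.
  by rewrite eqEdim subvf limg_dim_eq ?(eqP kF) ?capv0 // !dimvf dUV leqnn.
by case/memv_imgP => u _ ->; exists u; rewrite lfunE.
Qed.

Section Killing.
Variables (K : numClosedFieldType) (g : finLieAlgType K).
Implicit Types x y z : g.

Let bl : bilinear_for _ _ _ := @lie_bilinear K g.

Lemma lieDl x y z : lie (x + y) z = lie x z + lie y z. Proof. exact: bilDl bl _ _ _. Qed.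
Lemma lieDr z x y : lie z (x + y) = lie z x + lie z y. Proof. exact: bilDr bl _ _ _. Qed.
Lemma lieZl c x z : lie (c *: x) z = c *: lie x z. Proof. exact: bilZl bl _ _ _. Qed.
Lemma lieZr c z x : lie z (c *: x) = c *: lie z x. Proof. exact: bilZr bl _ _ _. Qed.
Lemma lie0l z : lie 0 z = 0. Proof. exact: bil0l bl _. Qed.
Lemma lie0r z : lie z 0 = 0. Proof. exact: bil0r bl _. Qed.
Lemma lieNl x z : lie (- x) z = - lie x z. Proof. exact: bilNl bl _ _. Qed.
Lemma lieNr z x : lie z (- x) = - lie z x. Proof. exact: bilNr bl _ _. Qed.
Lemma lie_suml (I : Type) (s : seq I) (F : I -> g) z :
  lie (\sum_(i <- s) F i) z = \sum_(i <- s) lie (F i) z.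
Proof. by elim/big_rec2: _ => [|i _ y _ <-]; rewrite ?lie0l ?lieDl. Qed.

Lemma lie_lie x y z : lie (lie x y) z = lie x (lie y z) - lie y (lie x z).
Proof.
have := lie_jacobi x y z; rewrite [lie z (lie x y)]lieC [lie z x]lieC lieNr.
by move/subr0_eq => <-.
Qed.

Lemma lie_derivation x y z : lie x (lie y z) = lie (lie x y) z + lie y (lie x z).
Proof. by rewrite lie_lie subrK. Qed.

(** The adjoint operator of x. *)
Definition ad x : g -> g := lie x.

Fact ad_linear x : linear (ad x).
Proof. by move=> c y z; rewrite /ad lieDr lieZr. Qed.

HB.instance Definition _ x := GRing.isLinear.Build K g g *:%R (ad x) (ad_linear x).

(** The matrix of the adjoint operator in coordinates.  It acts on row vectors
    from the right, so that composition is reversed in ad_mx_lie. *)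
Definition ad_mx x : 'M[K]_(dim g) :=
  lin1_mx (v2r \o ad x \o (r2v : 'rV[K]_(dim g) -> g)).

Lemma ad_mxE x y : v2r (lie x y) = v2r y *m ad_mx x.
Proof. by rewrite mul_rV_lin1 /= v2rK. Qed.

Lemma ad_mx_inj (A B : 'M[K]_(dim g)) : (forall y : g, v2r y *m A = v2r y *m B) -> A = B.
Proof.
move=> AB; apply/row_matrixP => i; rewrite !rowE.
by have := AB (r2v (delta_mx 0 i)); rewrite r2vK.
Qed.

Lemma ad_mxD x y : ad_mx (x + y) = ad_mx x + ad_mx y.
Proof. by apply: ad_mx_inj => z; rewrite mulmxDr -!ad_mxE lieDl linearD. Qed.

Lemma ad_mxZ c x : ad_mx (c *: x) = c *: ad_mx x.
Proof. by apply: ad_mx_inj => z; rewrite -scalemxAr -!ad_mxE lieZl linearZ. Qed.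

Lemma ad_mx_lie x y : ad_mx (lie x y) = ad_mx y *m ad_mx x - ad_mx x *m ad_mx y.
Proof.
by apply: ad_mx_inj => z; rewrite mulmxBr !mulmxA -!ad_mxE lie_lie linearB.
Qed.

(** The Killing form, as the trace of a product of adjoint matrices. *)
Definition killing x y : K := \tr (ad_mx x *m ad_mx y).

Lemma killingDr x y z : killing x (y + z) = killing x y + killing x z.
Proof. by rewrite /killing ad_mxD mulmxDr mxtraceD. Qed.
Lemma killingZr c x y : killing x (c *: y) = c * killing x y.
Proof. by rewrite /killing ad_mxZ -scalemxAr mxtraceZ. Qed.
Lemma killing0r x : killing x 0 = 0.
Proof. by rewrite -(scale0r (0 : g)) killingZr mul0r. Qed.
Lemma killingC x y : killing x y = killing y x.
Proof. exact: mxtrace_mulC. Qed.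
Lemma killing_sumr (I : Type) (s : seq I) (c : I -> K) (F : I -> g) x :
  killing x (\sum_(i <- s) c i *: F i) = \sum_(i <- s) c i * killing x (F i).
Proof.
by elim/big_rec2: _ => [|i _ y _ <-]; rewrite ?killing0r ?killingDr ?killingZr.
Qed.

Lemma killing_invariant x y z : killing (lie x y) z = killing x (lie y z).
Proof.
rewrite /killing !ad_mx_lie mulmxBl mulmxBr !raddfB /=; congr (_ - _); last by rewrite mulmxA.
by rewrite -mulmxA mxtrace_mulC mulmxA.
Qed.

End Killing.

(** * The coroots span the Cartan subalgebra *)

Section Cartan.
Variables (K : numClosedFieldType) (g : finLieAlgType K) (D : chevalleyData g).
Local Notation h := (cartan D).
Local Notation r := (\dim (cartan D)).
Local Notation alpha := (simple_root D).
Local Notation e := (chev_e D).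
Local Notation f := (chev_f D).
Local Notation hc := (chev_h D).
Implicit Types (t u : subvs_of h) (beta : dual h).

Lemma dualE0 t : (0 : dual h) t = 0 :> K. Proof. by rewrite lfunE. Qed.
Lemma dualDE beta gam t : (beta + gam : dual h) t = beta t + gam t :> K.
Proof. by rewrite lfunE. Qed.
Lemma dualNE beta t : (- beta : dual h) t = - beta t :> K.
Proof. by rewrite lfunE. Qed.
Lemma dualNr beta t : beta (- t) = - beta t :> K.
Proof. by rewrite linearN. Qed.
Lemma dual_sumE (I : Type) (s : seq I) (F : I -> dual h) t :
  (\sum_(i <- s) F i : dual h) t = \sum_(i <- s) F i t :> K.
Proof. by rewrite sum_lfunE. Qed.
Lemma dualMnE beta n t : (beta *+ n : dual h) t = (beta t : K) *+ n.
Proof. by elim: n => [|n IH]; rewrite ?mulr0n ?dualE0 // !mulrS dualDE IH. Qed.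

Lemma dual_comb beta (I : Type) (s : seq I) (c : I -> K) (F : I -> subvs_of h) :
  beta (\sum_(i <- s) c i *: F i) = \sum_(i <- s) c i * beta (F i) :> K.
Proof. by rewrite linear_sum; apply: eq_bigr => i _; rewrite linearZ. Qed.

Lemma simple_root_separates t : (forall i, alpha i t = 0 :> K) -> t = 0.
Proof.
move=> at0; have [_ /andP[/eqP spn _] _] := simple_rootP D.
have dual0 beta : beta t = 0 :> K.
  have : beta \in fullv by rewrite memvf.
  rewrite -spn => /coord_span ->.
  rewrite dual_sumE big1 // => i _.
  rewrite -tnth_nth; have /mapP[j _ ->] := mem_tnth i [tuple of [seq alpha i | i <- enum 'I_r]].
  by rewrite lfunE /= at0 scaler0.
have /coord_vbasis -> : t \in fullv by rewrite memvf.
apply: big1 => i _.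
have := dual0 (linfun (coord (vbasis fullv) i : subvs_of h -> K^o)).
by rewrite lfunE /= => ->; rewrite scale0r.
Qed.

Lemma cartan_closed t u : lie (vsval t) (vsval u) \in h.
Proof. by have [sub _ _] := cartanP D; apply: sub; exact: subvsP. Qed.

(** The Cartan subalgebra is abelian because the simple roots, which are
    characters of it, separate its elements. *)
Lemma cartan_abelian t u : lie (vsval t) (vsval u) = 0.
Proof.
rewrite -[LHS](vsprojK (cartan_closed t u)); set w := vsproj _ _.
suff -> : w = 0 by rewrite linear0.
apply: simple_root_separates => i.
have [rt _ _] := simple_rootP D; have [_ [x x0 xP]] := rt i.
have /eqP := xP w; rewrite /w vsprojK ?cartan_closed // lie_lie !xP !lieZr !xP.
rewrite !scalerA mulrC subrr eq_sym scaler_eq0 (negPf x0) orbF.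
by move=> /eqP.
Qed.

Lemma simple_root_surjective (c : 'I_r -> K) : exists t, forall i, alpha i t = c i :> K.
Proof.
pose ev (t : subvs_of h) : 'rV[K]_r := \row_i (alpha i t : K).
have ev_lin : linear ev.
  by move=> a t u; apply/rowP => i; rewrite !mxE linearP.
pose evL := HB.pack ev (GRing.isLinear.Build _ _ _ _ ev ev_lin) : {linear _ -> _}.
have [|t0 ev0|t /rowP tc] := @injective_surjective _ _ _ evL _ _ (\row_i c i).
- by rewrite /dim /= mul1n.
- apply: simple_root_separates => i.
  by have /rowP/(_ i) := ev0; rewrite !mxE.
- by exists t => i; have := tc i; rewrite !mxE.
Qed.

Lemma simple_root_free (c : 'I_r -> nat) :
  \sum_i alpha i *+ c i = 0 -> forall i, c i = 0%N.
Proof.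
move=> c0 i; have [t tP] := simple_root_surjective (fun j => (j == i)%:R).
have := congr1 (fun beta : dual h => beta t : K) c0; rewrite dual_sumE dualE0.
rewrite (bigD1 i) //= big1 => [|j ji]; rewrite dualMnE tP ?(negPf ji) ?mul0rn //.
by rewrite eqxx addr0 => /eqP; rewrite pnatr_eq0 => /eqP.
Qed.

Lemma root_space_lie beta gam x y : root_space beta x -> root_space gam y ->
  root_space (beta + gam) (lie x y).
Proof.
move=> bx gy t; rewrite lie_derivation bx gy lieZl lieZr -scalerDl.
by rewrite dualDE.
Qed.

Lemma chev_sl2_EF i x : lie (e i) (lie (f i) x) - lie (f i) (lie (e i) x) =
  lie (vsval (hc i)) x.
Proof. by rewrite chev_hE lie_lie. Qed.

Lemma chev_sl2_HE i x : lie (vsval (hc i)) (lie (e i) x) -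
  lie (e i) (lie (vsval (hc i)) x) = 2 *: lie (e i) x.
Proof. by rewrite -lie_lie chev_eP chev_hP lieZl. Qed.

Lemma chev_sl2_HF i x : lie (vsval (hc i)) (lie (f i) x) -
  lie (f i) (lie (vsval (hc i)) x) = - 2 *: lie (f i) x.
Proof. by rewrite -lie_lie chev_fP dualNE chev_hP lieZl. Qed.

Lemma chev_h_neq0 i : vsval (hc i) != 0.
Proof.
apply/eqP => h0; have := chev_hP i.
have -> : hc i = 0 by apply: val_inj; rewrite /= h0.
by rewrite linear0 => /eqP; rewrite eq_sym pnatr_eq0.
Qed.

Lemma chev_e_neq0 i : e i != 0.
Proof. by apply: contraNneq (chev_h_neq0 i) => e0; rewrite chev_hE e0 lie0l. Qed.

Lemma killing_chev_h i t :
  killing (vsval (hc i)) (vsval t) = alpha i t * killing (e i) (f i).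
Proof.
rewrite chev_hE killing_invariant lieC (chev_fP i t) dualNE scaleNr opprK.
exact: killingZr.
Qed.

Lemma ad_eigenvalue x c : eigenvalue (ad_mx x) c -> exists2 y : g, y != 0 & lie x y = c *: y.
Proof.
move=> /eigenvalueP[v vx v0]; exists (r2v v : g).
  by apply: contraNneq v0 => /(congr1 v2r); rewrite r2vK linear0 => ->.
by apply: v2r_inj; rewrite ad_mxE linearZ /= r2vK.
Qed.

Lemma ad_eigenvalueV x c (y : g) : y != 0 -> lie x y = c *: y -> eigenvalue (ad_mx x) c.
Proof.
move=> y0 xy; apply/eigenvalueP; exists (v2r y).
  by rewrite -ad_mxE xy linearZ.
by apply: contraNneq y0 => vy; apply/eqP/v2r_inj; rewrite vy linear0.
Qed.

(** In a simultaneous triangularization the coroots have integral diagonal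
    entries, so that the Killing form is a sum of squares on their span. *)
Lemma killing_chev_squares : exists d : 'I_r -> 'I_(dim g) -> int,
  (forall i, exists k, d i k != 0) /\
  forall i j, killing (vsval (hc i)) (vsval (hc j)) =
    \sum_k (d i k)%:~R * (d j k)%:~R.
Proof.
have [|d [dP trP]] := @commuting_trace_products K _ _ (fun i => ad_mx (vsval (hc i))).
  move=> i j; apply/eqP; rewrite -subr_eq0 -ad_mx_lie cartan_abelian.
  by rewrite -(scale0r (0 : g)) ad_mxZ scale0r.
have /choice[z zP] : forall p : 'I_r * 'I_(dim g), exists z : int, d p.1 p.2 = z%:~R.
  move=> [i k] /=; have /ad_eigenvalue[y y0 hy] : eigenvalue (ad_mx (vsval (hc i))) (d i k).
    by apply/dP; exists k.
  apply: (@sl2_weight_int K g (ad (e i)) (ad (vsval (hc i))) (ad (f i))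
    (@chev_sl2_EF i) (@chev_sl2_HE i) (@chev_sl2_HF i)
    [set 0]%classic (zero_subspace g) _ _ _ _ y).
  - by move=> x ->; rewrite linear0.
  - by move=> x ->; rewrite linear0.
  - by move=> x ->; rewrite linear0.
  - by apply/eqP.
  - by rewrite /= /ad hy subrr.
exists (fun i k => z (i, k)); split=> [i|i j]; last first.
  by rewrite /killing trP; apply: eq_bigr => k _; rewrite -!zP.
have /dP[k dk] : eigenvalue (ad_mx (vsval (hc i))) 2.
  apply: (ad_eigenvalueV (chev_e_neq0 i)).
  by rewrite (chev_eP i) chev_hP.
exists k; have := zP (i, k); rewrite /= -dk => zk.
by apply/eqP => z0; move/eqP: zk; rewrite z0 pnatr_eq0.
Qed.

Lemma killing_ef_gt0 i : 0 < killing (e i) (f i).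
Proof.
have [d [dn0 dP]] := killing_chev_squares.
have := dP i i; rewrite killing_chev_h chev_hP => kE.
rewrite -(pmulr_rgt0 _ (ltr0Sn K 1)) kE.
have [k dk] := dn0 i; rewrite (bigD1 k) //= ltr_pwDl //.
  by rewrite -rmorphM ltr0z /= -expr2 exprn_even_gt0.
by apply: sumr_ge0 => j _; rewrite -rmorphM ler0z /= -expr2 sqr_ge0.
Qed.

(** The coroots span the Cartan subalgebra. *)
Lemma chev_h_span t : exists c : 'I_r -> K, t = \sum_i c i *: hc i.
Proof.
pose s (c : 'rV[K]_r) : subvs_of h := \sum_i c 0 i *: hc i.
have s_lin : linear s.
  move=> a x y; rewrite /s scaler_sumr -big_split; apply: eq_bigr => i _.
  by rewrite !mxE scalerDl scalerA.
pose sL := HB.pack s (GRing.isLinear.Build _ _ _ _ s s_lin) : {linear _ -> _}.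
have [|c c0|c sc] := @injective_surjective _ _ _ sL _ _ t.
- by rewrite /dim /= mul1n.
- apply/rowP => i; rewrite mxE.
  have [u uP] := simple_root_surjective (fun j => (j == i)%:R).
  have : killing (vsval u) (vsval (s c)) = 0 by rewrite [s c]c0 linear0 killing0r.
  rewrite linear_sum /=.
  rewrite killing_sumr (bigD1 i) //= killingC killing_chev_h uP eqxx mul1r.
  rewrite big1 ?addr0 => [/eqP|j ji].
    by rewrite mulf_eq0 (gt_eqF (killing_ef_gt0 i)) orbF => /eqP.
  by rewrite killingC killing_chev_h uP (negPf ji) mul0r mulr0.
- by exists (fun i => c 0 i).
Qed.

End Cartan.

(** * Generation by the Chevalley generators *)

Section Generation.
Variables (K : numClosedFieldType) (g : finLieAlgType K) (D : chevalleyData g).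
Local Notation h := (cartan D).
Local Notation r := (\dim (cartan D)).
Local Notation alpha := (simple_root D).
Local Notation e := (chev_e D).
Local Notation f := (chev_f D).
Local Notation hc := (chev_h D).
Implicit Types (t u : subvs_of h) (beta : dual h).

(** The vector y has weight beta modulo the subspace S. *)
Definition weight_mod (S : set g) beta (y : g) :=
  forall t, S (lie (vsval t) y - (beta t : K) *: y).

Lemma weight_mod_chev_h (S : set g) beta y : is_subspace S ->
  (forall i, S (lie (vsval (hc i)) y - (beta (hc i) : K) *: y)) ->
  weight_mod S beta y.
Proof.
move=> sS Sh t; have [c ->] := chev_h_span t.
rewrite linear_sum /= lie_suml dual_comb scaler_suml -sumrB.
apply: (subspace_sum sS) => i _; rewrite lieZl -scalerA -scalerBr.
exact: subspaceZ.
Qed.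

Lemma dual_with_values (c : 'I_r -> K) : exists beta : dual h, forall i, beta (hc i) = c i.
Proof.
pose ev (beta : dual h) : 'rV[K]_r := \row_i (beta (hc i) : K).
have ev_lin : linear ev.
  by move=> a b1 b2; apply/rowP => i; rewrite !mxE dualDE lfunE.
pose evL := HB.pack ev (GRing.isLinear.Build _ _ _ _ ev ev_lin) : {linear _ -> _}.
have [|beta b0|beta /rowP bc] := @injective_surjective _ _ _ evL _ _ (\row_i c i).
- by rewrite /dim /= mul1n muln1.
- apply/lfunP => t; have [a ->] := chev_h_span t.
  rewrite dual_comb lfunE big1 // => i _.
  by have /rowP/(_ i) := b0; rewrite !mxE => ->; rewrite mulr0.
- by exists beta => i; have := bc i; rewrite !mxE.
Qed.

Lemma root_comb_real (c : 'I_r -> nat) i :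
  (\sum_j alpha j *+ c j : dual h) (hc i) \is Num.real.
Proof.
rewrite dual_sumE; apply: rpred_sum => j _; rewrite dualMnE rpredMn //.
have [z ->] : exists z : int, alpha j (hc i) = z%:~R.
  apply: (@sl2_weight_int K g (ad (e i)) (ad (vsval (hc i))) (ad (f i))
    (@chev_sl2_EF _ _ D i) (@chev_sl2_HE _ _ D i) (@chev_sl2_HF _ _ D i)
    [set 0]%classic (zero_subspace g) _ _ _ _ (e j)).
  - by move=> x ->; rewrite linear0.
  - by move=> x ->; rewrite linear0.
  - by move=> x ->; rewrite linear0.
  - by apply/eqP; exact: chev_e_neq0.
  - by rewrite /= /ad (chev_eP j) subrr.
exact: rpred_int.
Qed.

(** A nonzero sum of simple roots with natural coefficients is positive on
    some coroot occurring in it: its pairing with itself is positive for the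
    Killing form. *)
Lemma root_comb_positive (c : 'I_r -> nat) : (exists i, c i != 0)%N ->
  exists2 i, (0 < c i)%N & 0 < (\sum_j alpha j *+ c j : dual h) (hc i) :> K.
Proof.
move=> [i0 ci0]; set beta := \sum_j _.
pose k i := killing (e i) (f i); pose a i := (c i)%:R / k i.
have k_gt0 i : 0 < k i by exact: killing_ef_gt0.
have a_ge0 i : 0 <= a i by rewrite divr_ge0 ?ler0n // ltW.
pose t : subvs_of h := \sum_i a i *: hc i.
have killing_t u : killing (vsval t) (vsval u) = beta u.
  rewrite killingC linear_sum /= killing_sumr dual_sumE; apply: eq_bigr => i _.
  rewrite killingC killing_chev_h dualMnE mulrCA /a /k divfK ?gt_eqF ?killing_ef_gt0 //.
  by rewrite mulr_natr.
have [d [dn0 dP]] := killing_chev_squares D.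
have kill_hh : forall l, killing (vsval (hc l)) (vsval t) =
    \sum_m (d l m)%:~R * (\sum_j a j * (d j m)%:~R).
  move=> l.
  rewrite linear_sum /= killing_sumr.
  under [LHS]eq_bigr do rewrite dP mulr_sumr.
  rewrite exchange_big; apply: eq_bigr => m _ /=; rewrite mulr_sumr.
  by apply: eq_bigr => j _; rewrite mulrCA.
have kill_tt : killing (vsval t) (vsval t) =
    \sum_m (\sum_j a j * (d j m)%:~R) ^+ 2.
  have tE : vsval t = \sum_i a i *: vsval (hc i) by rewrite linear_sum.
  rewrite [X in killing _ X]tE killing_sumr.
  under [LHS]eq_bigr do rewrite killingC kill_hh mulr_sumr.
  rewrite exchange_big; apply: eq_bigr => m _ /=; rewrite expr2 mulr_suml.
  by apply: eq_bigr => j _; rewrite mulrA.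
have sum_real m : \sum_j a j * (d j m)%:~R \is Num.real.
  by apply: rpred_sum => j _; rewrite rpredM ?rpred_int // ger0_real.
apply: contrapT => nex.
have le0 : beta t <= 0.
  rewrite dual_comb; apply: sumr_le0 => i _.
  have [ci|] := posnP (c i); first by rewrite /a ci !mul0r.
  move=> ci; rewrite mulr_ge0_le0 //.
  have := root_comb_real c i; rewrite -/beta => /real_leP -/(_ 0 (real0 K)).
  by case=> // b_gt0; case: nex; exists i.
have kt0 : killing (vsval t) (vsval t) = 0.
  apply/le_anti; rewrite {1}killing_t le0 kill_tt sumr_ge0 // => m _.
  exact: real_exprn_even_ge0.
have sum0 m : \sum_j a j * (d j m)%:~R = 0.
  apply/eqP; rewrite -sqrf_eq0; move: kt0; rewrite kill_tt => /eqP.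
  rewrite psumr_eq0 => [/allP/(_ m)|j _]; last exact: real_exprn_even_ge0.
  by rewrite mem_index_enum => /(_ isT).
have beta0 : beta = 0.
  apply/lfunP => u; rewrite lfunE /=; have [b ->] := chev_h_span u.
  rewrite dual_comb big1 // => i _; rewrite -killing_t killingC kill_hh.
  by rewrite big1 ?mulr0 // => m _; rewrite sum0 mulr0.
by have := simple_root_free beta0 i0 => /eqP; rewrite (negPf ci0).
Qed.

Section Stable.
Variable S : set g.
Hypotheses (sS : is_subspace S) (hS : forall x, x \in h -> S x).
Hypothesis Sh : forall i x, S x -> S (lie (vsval (hc i)) x).
Hypothesis Se : forall i x, S x -> S (lie (e i) x).
Hypothesis Sf : forall i x, S x -> S (lie (f i) x).

Let T i : {linear g -> g} := ad (vsval (hc i)).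

Let T_comm i j x : T i (T j x) = T j (T i x).
Proof.
by apply/eqP; rewrite -subr_eq0 /T /= /ad -lie_lie cartan_abelian lie0l.
Qed.

Let S_T i x : S x -> S (T i x). Proof. exact: Sh. Qed.

(** The weights of g / S are roots; in particular zero is not one of them,
    as h is its own generalized weight space of weight zero. *)
Lemma quotient_weight_root beta y : ~ S y -> weight_mod S beta y -> is_root beta.
Proof.
move=> nSy Sy.
pose U : set g := [set z | forall i, S (T i z - (beta (hc i) : K) *: z)]%classic.
have [] := @joint_eigenvector K g _ T S U y T_comm sS S_T _ _ nSy _.
- split=> [i|c x z Ux Uz i].
    by rewrite linear0 scaler0 subrr; exact: subspace0.
  rewrite linD linZ scalerDr scalerA mulrC -scalerA opprD addrACA -scalerBr.
  by apply: (subspaceD sS) => //; exact: subspaceZ.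
- by move=> j x Ux i; rewrite T_comm -linZ -linB; exact: S_T.
- by move=> i; exact: Sy.
move=> z [a [m [nSz Uz zP]]].
have aE i : a i = beta (hc i).
  have [Sz _] := zP i; apply/eqP; rewrite -subr_eq0.
  apply: contra_notT nSz => ab; apply: (subspaceZE sS ab).
  have := subspaceB sS (Uz i) Sz; rewrite opprB addrC subrKA.
  by rewrite scalerBl.
have zm i : shifts (T i) (nseq (m i) (beta (hc i))) z = 0.
  by rewrite -aE; have [] := zP i.
split.
- apply/eqP => b0; have [] := @generalized_eigenspace_eigenvector K g _ T
    [set x | x \in h]%classic (fun i => beta (hc i)) m z T_comm (vspace_subspace h)
    _ _ zm.
  + by move=> i x xh /=; rewrite /T /= /ad -(vsprojK xh) cartan_abelian mem0v.
  + by move=> zh; apply: nSz; apply: hS.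
  move=> x xh xP; apply: xh => /=; have [_ _ self] := cartanP D; apply: self.
  move=> w /vsprojK <-; set t := vsproj _ w; have [c ->] := chev_h_span t.
  rewrite lieC linear_sum /= lie_suml memvN memv_suml // => i _.
  rewrite lieZl memvZ //; have := xP i; rewrite /= b0 dualE0 scale0r subr0.
  by [].
- have [] := @generalized_eigenspace_eigenvector K g _ T
    [set 0]%classic (fun i => beta (hc i)) m z T_comm (zero_subspace g) _ _ zm.
  + by move=> i x ->; rewrite linear0.
  + by move=> z0; apply: nSz; rewrite z0; exact: subspace0.
  move=> x /eqP x0 xP; exists x => // t.
  have := weight_mod_chev_h (zero_subspace g) xP t.
  by move/subr0_eq.
Qed.

Lemma stable_cartan t x : S x -> S (lie (vsval t) x).
Proof.
move=> Sx; have [c ->] := chev_h_span t; rewrite linear_sum /= lie_suml.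
by apply: (subspace_sum sS) => i _; rewrite lieZl; apply: (subspaceZ sS); exact: Sh.
Qed.

(** No weight of g / S is a combination of simple roots with natural
    coefficients.  Being positive on some coroot of its support, it remains
    a weight after subtraction of the corresponding simple root, so that one
    could descend to the weight zero.  This is stated so as to apply both to
    the simple roots and to their opposites. *)
Lemma root_descent (a : 'I_r -> dual h) (E F : 'I_r -> g) (H : 'I_r -> subvs_of h) :
  (forall i x, lie (E i) (lie (F i) x) - lie (F i) (lie (E i) x) = lie (vsval (H i)) x) ->
  (forall i x, lie (vsval (H i)) (lie (E i) x) - lie (E i) (lie (vsval (H i)) x) =
     2 *: lie (E i) x) ->
  (forall i, root_space (- a i) (F i)) ->
  (forall i x, S x -> S (lie (E i) x)) -> (forall i x, S x -> S (lie (F i) x)) ->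
  (forall c : 'I_r -> nat, (exists i, c i != 0)%N ->
     exists2 i, (0 < c i)%N & 0 < (\sum_j a j *+ c j : dual h) (H i) :> K) ->
  forall n (c : 'I_r -> nat) y, (\sum_i c i)%N = n -> ~ S y ->
    weight_mod S (\sum_j a j *+ c j) y -> False.
Proof.
move=> EF HE Fa SE SF pos; elim=> [|n IH] c y cn nSy Sy.
  have [b0 _] := quotient_weight_root nSy Sy; move/eqP: b0; apply.
  apply: big1 => i _; move/eqP: cn; rewrite sum_nat_eq0 => /forallP/(_ i) /eqP ->.
  by rewrite mulr0n.
have [|i ci bi] := pos c.
  apply: contrapT => nex; move: cn; rewrite big1 // => i _.
  by apply/eqP; apply: contra_notT nex => ci; exists i.
set b := \sum_j _ in Sy bi.
have nSF : ~ S (lie (F i) y).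
  move=> SFy.
  have [] := @sl2_highest_weight K g (ad (F i)) (ad (- vsval (H i))) (ad (E i))
    _ _ S sS _ _ _ (- ((b : dual h) (H i) : K)) y nSy _ SFy.
  - by move=> x; rewrite /= /ad lieNl -EF opprB.
  - by move=> x; rewrite /= /ad !lieNl lieNr -opprD HE scaleNr.
  - by move=> x; exact: SF.
  - by move=> x Sx; rewrite /= /ad -linearN; exact: stable_cartan.
  - by move=> x; exact: SE.
  - rewrite /= /ad lieNl scaleNr -opprD -[X in S X]scaleN1r; apply: (subspaceZ sS).
    exact: Sy.
  move=> m /eqP; rewrite eqr_oppLR => /eqP bm; move: bi; rewrite bm.
  by rewrite oppr_gt0 ltrn0.
pose c' j := (c j - (j == i))%N.
have cE j : c j = (c' j + (j == i))%N.
  by rewrite /c' subnK //; case: eqP => // ->.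
have bE : b = \sum_j a j *+ c' j + a i.
  rewrite /b (eq_bigr _ (fun j _ => congr1 _ (cE j))).
  under eq_bigr do rewrite mulrnDr.
  rewrite big_split /=; congr (_ + _); rewrite (bigD1 i) //= eqxx big1 ?addr0 //.
  by move=> j /negPf ->.
apply: (IH c' _ _ nSF) => [|t].
  have : (\sum_j c j = \sum_j c' j + 1)%N.
    rewrite (eq_bigr _ (fun j _ => cE j)) big_split /=; congr (_ + _)%N.
    by rewrite (bigD1 i) //= eqxx big1 // => j /negPf ->.
  by rewrite cn addn1 => -[].
have := SF i _ (Sy t); rewrite lieDr lieNr lieZr bE.
have -> : lie (F i) (lie (vsval t) y) = lie (vsval t) (lie (F i) y) + (a i t : K) *: lie (F i) y.
  by rewrite [lie _ (lie (F i) y)]lie_derivation (Fa i t) dualNE lieZl scaleNr addrAC addNr add0r.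
by rewrite dualDE scalerDl opprD addrACA subrr addr0.
Qed.

(** A subspace which contains the Cartan subalgebra and is stable under the
    Chevalley generators is the whole algebra. *)
Lemma stable_full x : S x.
Proof.
apply: contrapT => nSx.
have [] := @joint_eigenvector K g _ T S setT x T_comm sS S_T _ _ nSx I.
- by split.
- by [].
move=> y [c [m [nSy _ yP]]]; have [b bP] := dual_with_values c.
have Sy : weight_mod S b y.
  apply: weight_mod_chev_h => // i; rewrite bP; have [Sy _] := yP i; exact: Sy.
have [_ _ base] := simple_rootP D.
have [[a aE]|[a aE]] := base _ (quotient_weight_root nSy Sy).
  apply: (@root_descent alpha e f hc _ _ _ Se Sf _ _ a y (erefl _) nSy _).
  - exact: chev_sl2_EF.
  - exact: chev_sl2_HE.
  - exact: chev_fP.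
  - exact: root_comb_positive.
  - by rewrite -aE.
apply: (@root_descent (fun i => - alpha i) f e (fun i => - hc i) _ _ _ Sf Se _ _ a y (erefl _) nSy _).
- by move=> i z; rewrite linearN lieNl -chev_sl2_EF opprB.
- move=> i z; rewrite linearN !lieNl lieNr -opprD chev_sl2_HF.
  by rewrite scaleNr opprK.
- by move=> i; rewrite opprK; exact: chev_eP.
- move=> k /root_comb_positive[i ki pos]; exists i => //.
  have -> : \sum_j - alpha j *+ k j = - \sum_j alpha j *+ k j :> dual h.
    by rewrite -sumrN; apply: eq_bigr => j _; rewrite mulNrn.
  by rewrite dualNr dualNE opprK.
- rewrite (_ : \sum_j _ = b) // -[b]opprK aE -sumrN.
  by apply: eq_bigr => j _; rewrite mulNrn.
Qed.

End Stable.
End Generation.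

(** * Positive root vectors and the nilpotent radical *)

Section LinearSpan.
Variables (K : fieldType) (V : lmodType K) (X : set V).

Lemma lspan_subspace : is_subspace (lspan X).
Proof.
split=> [U [sU _]|c x y Xx Xy U UX]; first exact: subspace0.
by have [sU _] := UX; apply: sU.2; [exact: Xx | exact: Xy].
Qed.

Lemma sub_lspan x : X x -> lspan X x.
Proof. by move=> Xx U [_]; apply. Qed.

Lemma lspan_min (U : set V) x :
  is_subspace U -> (forall y, X y -> U y) -> lspan X x -> U x.
Proof. by move=> sU XU; apply; split. Qed.
End LinearSpan.

Section NilpotentRadical.
Variables (K : numClosedFieldType) (g : finLieAlgType K) (D : chevalleyData g).
Local Notation h := (cartan D).
Local Notation r := (\dim (cartan D)).
Local Notation alpha := (simple_root D).

(** The span of the root vectors of height at least k. *)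
Definition height_ge k : set g := lspan [set x | exists c : 'I_r -> nat,
  [/\ is_root (\sum_i alpha i *+ c i), (k <= \sum_i c i)%N &
      root_space (\sum_i alpha i *+ c i) x]]%classic.

Let sH k : is_subspace (height_ge k) := lspan_subspace _.

Lemma height_geD j k x y : (0 < j)%N ->
  height_ge j x -> height_ge k y -> height_ge (j + k) (lie x y).
Proof.
move=> j_gt0 Hx; move: x Hx y.
pose U : set g := [set x | forall y, height_ge k y -> height_ge (j + k) (lie x y)]%classic.
move=> {}x; apply: (@lspan_min _ _ _ U x).
  split=> [y _|c x1 x2 U1 U2 y Hy]; first by rewrite lie0l; exact: subspace0.
  rewrite lieDl lieZl; apply: (subspaceD (sH _)); last exact: U2.
  by apply: (subspaceZ (sH _)); exact: U1.
move=> {}x [c [[c0 _] cj cx]].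
move=> y; apply: (@lspan_min _ _ _ [set y | height_ge (j + k) (lie x y)]%classic y).
  split=> [|a y1 y2 U1 U2]; first by rewrite /= lie0r; exact: subspace0.
  rewrite /= lieDr lieZr; apply: (subspaceD (sH _)) => //.
  exact: (subspaceZ (sH _)).
move=> {}y [d [_ dk dy]] /=.
have [->|/eqP xy0] := pselect (lie x y = 0); first exact: subspace0.
have cdE : \sum_i alpha i *+ c i + \sum_i alpha i *+ d i =
    \sum_i alpha i *+ (c i + d i) :> dual h.
  by rewrite -big_split; apply: eq_bigr => i _; rewrite mulrnDr.
have cdxy := root_space_lie cx dy; rewrite cdE in cdxy.
apply: sub_lspan; exists (fun i => c i + d i)%N; split=> //; last first.
  by rewrite big_split leq_add.
split; last by exists (lie x y).
apply/eqP => /(@simple_root_free _ _ D (fun i => c i + d i)%N) cd0.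
move: cj; rewrite leqNgt big1 ?j_gt0 // => i _.
by have /eqP := cd0 i; rewrite addn_eq0 => /andP[/eqP].
Qed.

Lemma natr_leaves (l : seq K) : exists M, forall n, (M <= n)%N -> n%:R \notin l.
Proof.
elim: l => [|a l [M IH]]; first by exists 0%N.
have [[m ->]|am] := pselect (exists m : nat, a = m%:R).
  exists (maxn M m.+1) => n; rewrite geq_max => /andP[Mn mn].
  by rewrite inE eqr_nat gtn_eqF //= IH.
exists M => n Mn; rewrite inE negb_or IH // andbT.
by apply/eqP => an; apply: am; exists n.
Qed.

(** The height of a root is an eigenvalue of the adjoint operator of the element
    on which all simple roots are 1. *)
Lemma height_bounded : exists M, forall x, height_ge M x -> x = 0.
Proof.
have [rho rhoP] := @simple_root_surjective _ _ D (fun=> 1).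
have [l lP] := finite_spectrum (ad (vsval rho)).
have [M MP] := natr_leaves l; exists M.
move=> x; apply: (@lspan_min _ _ _ [set 0]%classic x).
  exact: zero_subspace.
move=> {}x [c [_ cM cx]]; apply: contrapT => x0.
have /negP := MP _ cM; apply.
apply: (lP [set 0]%classic _ x) => //; first exact: zero_subspace.
  by move=> y ->; rewrite linear0.
rewrite /= /ad cx dual_sumE natr_sum.
rewrite [X in X *: x - _](_ : _ = \sum_i (c i)%:R) ?subrr //.
by apply: eq_bigr => i _; rewrite dualMnE rhoP.
Qed.

(** The positive root vectors span an ideal of the Borel subalgebra which is
    nilpotent because the heights of roots are bounded; hence they lie in the
    nilpotent radical. *)
Lemma n_plus_root_vector i : n_plus D (chev_e D i).
Proof.
have /choice[N NP] : forall k, exists I : {vspace g}, forall x, x \in I <-> height_ge k x.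
  by move=> k; exact: subspace_vspace.
have [rt _ _] := simple_rootP D.
have pos c : is_root (\sum_i alpha i *+ c i) -> (0 < \sum_i c i)%N.
  move=> [c0 _]; rewrite lt0n; apply: contra c0; rewrite sum_nat_eq0 => /forallP s0.
  by rewrite big1 // => j _; rewrite (eqP (s0 j)) mulr0n.
exists (N 1%N); split.
- move=> y /NP; apply: (lspan_min (lspan_subspace _)).
  move=> x [c [rc _ cx]]; apply: sub_lspan; right; exists (\sum_i alpha i *+ c i).
  by split=> //; split=> //; exists c.
- move=> b y bb /NP Hy; apply/NP; move: b bb y Hy.
  pose U : set g := [set b | forall y, height_ge 1 y -> height_ge 1 (lie b y)]%classic.
  move=> b; apply: (@lspan_min _ _ _ U b).
    split=> [y _|c x1 x2 U1 U2 y Hy]; first by rewrite lie0l; exact: subspace0.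
    rewrite lieDl lieZl; apply: (subspaceD (sH _)); last exact: U2.
    by apply: (subspaceZ (sH _)); exact: U1.
  move=> {}b [bh|[beta [[rb [c cE]] bx]]] y Hy; last first.
    have H1b : height_ge 1 b.
      by apply: sub_lspan; exists c; rewrite -cE; split=> //; apply: pos; rewrite -cE.
    have := height_geD (ltnSn 0) H1b Hy.
    apply: (lspan_min (sH _)) => z [d [rd _ dz]]; apply: sub_lspan; exists d.
    by split=> //; exact: pos.
  rewrite -(vsprojK bh); move: y Hy.
  move=> y; apply: (@lspan_min _ _ _ [set y | height_ge 1 (lie (vsval (vsproj h b)) y)]%classic y).
    split=> [|a y1 y2 U1 U2]; first by rewrite /= lie0r; exact: subspace0.
    rewrite /= lieDr lieZr; apply: (subspaceD (sH _)) => //.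
    exact: (subspaceZ (sH _)).
  move=> {}y [d [rd d1 dy]] /=; rewrite dy; apply: (subspaceZ (sH _)).
  by apply: sub_lspan; exists d.
- have [M MP] := height_bounded; exists M.
  suff sub k : (iter k (lie_space (N 1%N)) (N 1%N) <= N k.+1)%VS.
    apply/eqP; rewrite -subv0; apply/subvP => x xM.
    rewrite memv0; apply/eqP/MP.
    have /NP : x \in N M.+1 by apply: (subvP (sub M)).
    apply: (lspan_min (sH _)) => z [d [rd dM dz]]; apply: sub_lspan; exists d.
    by split=> //; exact: ltnW.
  elim: k => [|k IH]; first exact: subvv.
  rewrite iterS; apply/span_subvP => z /allpairsP[[x y] /= [xN yN ->]].
  apply/NP; rewrite -add1n; apply: height_geD => //; apply/NP.
    exact: vbasis_mem.
  by apply: (subvP IH); exact: vbasis_mem.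
- apply/NP; apply: sub_lspan; exists (fun j => (j == i) : nat).
  have -> : \sum_j alpha j *+ (j == i) = alpha i.
    by rewrite (bigD1 i) //= eqxx big1 ?addr0 // => j /negPf ->.
  split; [exact: rt | | exact: chev_eP].
  by rewrite (bigD1 i) //= eqxx.
Qed.

End NilpotentRadical.

(** * Modules over Lie algebras *)

Section LieModuleLinearity.
Variables (K : fieldType) (L : lieAlgType K) (N : lieModule L).
Implicit Types (x y : L) (v w : N).
Let ba := @act_bilinear K L N.
Lemma actDl x y v : act (x + y) v = act x v + act y v. Proof. exact: bilDl ba _ _ _. Qed.
Lemma actDr x v w : act x (v + w) = act x v + act x w. Proof. exact: bilDr ba _ _ _. Qed.
Lemma actZl c x v : act (c *: x) v = c *: act x v. Proof. exact: bilZl ba _ _ _. Qed.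
Lemma actZr c x v : act x (c *: v) = c *: act x v. Proof. exact: bilZr ba _ _ _. Qed.
Lemma act0l v : act (0 : L) v = 0. Proof. exact: bil0l ba _. Qed.
Lemma act0r x : act x (0 : N) = 0. Proof. exact: bil0r ba _. Qed.
Lemma actNl x v : act (- x) v = - act x v. Proof. exact: bilNl ba _ _. Qed.
Lemma actNr x v : act x (- v) = - act x v. Proof. exact: bilNr ba _ _. Qed.
Lemma act_suml (I : Type) (s : seq I) (F : I -> L) v :
  act (\sum_(i <- s) F i) v = \sum_(i <- s) act (F i) v.
Proof. by elim/big_rec2: _ => [|i _ y _ <-]; rewrite ?act0l ?actDl. Qed.
Lemma act_sumr (I : Type) (s : seq I) (F : I -> N) x :
  act x (\sum_(i <- s) F i) = \sum_(i <- s) act x (F i).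
Proof. by elim/big_rec2: _ => [|i _ y _ <-]; rewrite ?act0r ?actDr. Qed.

Lemma act_derivation x y v : act x (act y v) = act (lie x y) v + act y (act x v).
Proof. by rewrite act_lie subrK. Qed.

Lemma generated_ind (v : N) (U : set N) :
  generated_by v -> is_submodule U -> U v -> forall w, U w.
Proof.
move=> gen subU Uv w; have : (smallest (@is_submodule _ _ N) [set v])%classic w.
  by rewrite gen.
by apply; split=> // _ ->.
Qed.

End LieModuleLinearity.

Lemma linear_zero (K : fieldType) (V W : lmodType K) (p : V -> W) : linear p -> p 0 = 0.
Proof. by move=> lp; have := lp (-1) 0 0; rewrite scaler0 addr0 scaleN1r addNr. Qed.

Section CurrentModules.
Variables (K : fieldType) (g : lieAlgType K) (M : affineVariety K).
Implicit Types N : lieModule (current g M).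

Lemma curDl (x y : g) (P : regfun M) : cur (x + y) P = cur x P + cur y P.
Proof. exact: bilDl (cur_bilinear _ _) _ _ _. Qed.
Lemma curDr (x : g) (P Q : regfun M) : cur x (P + Q) = cur x P + cur x Q.
Proof. exact: bilDr (cur_bilinear _ _) _ _ _. Qed.
Lemma curZl c (x : g) (P : regfun M) : cur (c *: x) P = c *: cur x P.
Proof. exact: bilZl (cur_bilinear _ _) _ _ _. Qed.
Lemma curNr (x : g) (P : regfun M) : cur x (- P) = - cur x P.
Proof. exact: bilNr (cur_bilinear _ _) _ _. Qed.
Lemma cur0l (P : regfun M) : cur (0 : g) P = 0.
Proof. exact: bil0l (cur_bilinear _ _) _. Qed.
Lemma cur_suml (I : Type) (s : seq I) (F : I -> g) (P : regfun M) :
  cur (\sum_(i <- s) F i) P = \sum_(i <- s) cur (F i) P.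
Proof. by elim/big_rec2: _ => [|i _ y _ <-]; rewrite ?cur0l ?curDl. Qed.

Lemma act_cur_comm N (x y : g) (P Q : regfun M) (v : N) :
  act (cur x P) (act (cur y Q) v) =
  act (cur (lie x y) (P * Q)) v + act (cur y Q) (act (cur x P) v).
Proof. by rewrite act_derivation lie_cur. Qed.

Lemma cur_submodule N (U : set N) : is_subspace U ->
  (forall x P v, U v -> U (act (cur x P) v)) -> is_submodule U.
Proof.
move=> sU Uact; split=> // s v Uv; elim/current_ind: s => [|x P s IH].
  by rewrite act0l; exact: subspace0.
by rewrite actDl; apply: subspaceD => //; exact: Uact.
Qed.

Lemma cur_module_hom N N' (p : N -> N') : linear p ->
  (forall x P v, p (act (cur x P) v) = act (cur x P) (p v)) -> is_module_hom p.
Proof.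
move=> lp pc s v; elim/current_ind: s => [|x P s IH].
  by rewrite !act0l linear_zero.
rewrite !actDl -IH -pc; have := lp 1 (act (cur x P) v) (act s v).
by rewrite !scale1r.
Qed.

End CurrentModules.

(** * Weights of integrable modules *)

Section WeightSpaces.
Variables (K : numClosedFieldType) (g : finLieAlgType K) (D : chevalleyData g).
Implicit Types V : lieModule g.

(** A subspace stable under the Cartan subalgebra contains the weight
    components of its elements.  For the zero subspace this says that weight
    vectors of distinct weights are linearly independent. *)
Lemma weight_components V (U : set V) (S : seq (hstar D)) (u : hstar D -> V) :
  is_subspace U -> (forall t y, U y -> U (act (vsval (t : subvs_of (cartan D))) y)) ->
  uniq S -> (forall mu, mu \in S -> weight_space mu (u mu)) ->
  U (\sum_(mu <- S) u mu) -> forall mu, mu \in S -> U (u mu).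
Proof.
move=> sU Ut; elim: S u => [|nu S IH] u //= /andP[nuS uS] uw.
rewrite big_cons => Usum.
have US mu : mu \in S -> U (u mu).
  move=> muS; have mu_nu : mu != nu by apply: contraNneq nuS => <-.
  have [t tP] : exists t, mu t != nu t.
    apply: contrapT => nex; move/eqP: mu_nu; apply; apply/lfunP => t.
    by apply/eqP; apply: contrapT => /negP tP; apply: nex; exists t.
  have Uu : U (((mu t : K) - nu t) *: u mu).
    apply: (IH (fun m => ((m t : K) - nu t) *: u m)) => // [m mS s|].
      rewrite actZr (uw m) ?inE ?mS ?orbT // !scalerA mulrC //.
    have := subspaceB sU (Ut t _ Usum) (subspaceZ sU (nu t) Usum).
    rewrite actDr act_sumr (uw nu) ?mem_head // scalerDr opprD addrACA subrr add0r.
    rewrite scaler_sumr -sumrB; congr U; apply: eq_big_seq => m mS.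
    by rewrite (uw m) ?inE ?mS ?orbT // scalerBl.
  by apply: (subspaceZE sU _ Uu); rewrite subr_eq0.
move=> mu; rewrite inE => /predU1P[->|]; last exact: US.
apply: (subspaceDl sU _ (x := \sum_(m <- S) u m)); last by rewrite addrC.
by rewrite big_seq; apply: (subspace_sum sU) => m; exact: US.
Qed.

Lemma integrable_of_decomposition V (S : seq (hstar D)) :
  (forall mu, mu \in S -> weight_lattice mu) ->
  (forall v : V, exists2 u : hstar D -> V,
     forall mu, mu \in S -> weight_space mu (u mu) &
     v = \sum_(mu <- undup S) u mu) -> integrable D V.
Proof.
move=> SP dec; exists (undup S); split=> [|mu|v|u uw u0 mu muS].
- exact: undup_uniq.
- by rewrite mem_undup; exact: SP.
- have [u uw ->] := dec v; exists u => // mu; rewrite mem_undup; exact: uw.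
- apply: (@weight_components V [set 0]%classic (undup S) u (zero_subspace V)) => //.
  + by move=> t y ->; rewrite /= act0r.
  + exact: undup_uniq.
Qed.

Lemma integrable_finite_weights V : integrable D V ->
  exists S : seq (hstar D), forall nu (v : V), weight_space nu v -> nu \notin S -> v = 0.
Proof.
move=> [S [uS _ dec _]]; exists S => nu v vnu nuS.
have [u uw vE] := dec v.
pose u' mu := if mu == nu then - v else u mu.
suff : [set 0]%classic (u' nu).
  by rewrite /u' eqxx => /= /eqP; rewrite oppr_eq0 => /eqP.
apply: (@weight_components V [set 0]%classic (nu :: S) u' (zero_subspace V)).
- by move=> t y ->; rewrite /= act0r.
- by rewrite /= nuS.
- move=> mu; rewrite inE /u'; case: eqP => [-> _ t|_ /= muS]; last exact: uw.
  by rewrite actNr vnu scalerN.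
- rewrite /= big_cons {1}/u' eqxx {1}vE; apply/eqP; rewrite addrC subr_eq0.
  apply/eqP/eq_big_seq => mu muS; rewrite /u'; case: eqP => // muE.
  by rewrite -muE muS in nuS.
- exact: mem_head.
Qed.

End WeightSpaces.

(** * Nilpotency of the action of functions vanishing on the multiset *)

Section Merging.

(** All lists obtained from s by adding a to one of its entries. *)
Fixpoint add_one (a : nat) (s : seq nat) : seq (seq nat) :=
  if s is b :: s' then ((b + a)%N :: s') :: map (cons b) (add_one a s') else [::].

(** All lists obtained from s by merging two of its entries into their sum. *)
Fixpoint merges (s : seq nat) : seq (seq nat) :=
  if s is a :: s' then add_one a s' ++ map (cons a) (merges s') else [::].

Lemma add_oneP a s t : t \in add_one a s -> size t = size s /\ sumn t = (a + sumn s)%N.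
Proof.
elim: s t => //= b s IH t; rewrite inE => /predU1P[->|/mapP[t' /IH[st tt] ->]] /=.
  by split; rewrite // addnAC addnC addnA.
by rewrite st tt; split; rewrite // addnCA.
Qed.

Lemma add_one_pos a s t : t \in add_one a s -> all (leq 1) s -> all (leq 1) t.
Proof.
elim: s t => //= b s IH t; rewrite inE => /predU1P[->|/mapP[t' /IH tP ->]] /andP[b0 s0] /=.
  by rewrite s0 andbT ltn_addr.
by rewrite b0 tP.
Qed.

Lemma mergesP s t : t \in merges s ->
  [/\ (size t).+1 = size s, sumn t = sumn s & all (leq 1) s -> all (leq 1) t].
Proof.
elim: s t => //= a s IH t; rewrite mem_cat => /orP[ts|/mapP[t' /IH[st tt tp] ->]] /=.
  have [-> ->] := add_oneP ts; split=> // /andP[_]; exact: add_one_pos ts.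
by rewrite st tt; split=> // /andP[-> /tp].
Qed.

End Merging.

Section HighestWeight.
Variables (K : numClosedFieldType) (g : finLieAlgType K) (D : chevalleyData g).
Variable M : affineVariety K.
Local Notation h := (cartan D).
Local Notation r := (\dim (cartan D)).
Local Notation alpha := (simple_root D).
Local Notation e := (chev_e D).
Local Notation f := (chev_f D).
Local Notation hc := (chev_h D).

(** A highest weight vector of weight lam on which h_i (x) P acts by the scalar
    chi i P. *)
Definition highest_weight_vector (N : lieModule (current g M)) (v : N)
    (lam : hstar D) (chi : 'I_r -> regfun M -> K) : Prop :=
  [/\ forall x (P : regfun M), n_plus D x -> act (cur x P) v = 0,
      forall P i, act (cur (vsval (hc i)) P) v = chi i P *: v &
      forall i, chi i 1 = lam (hc i)].

Variables (N : lieModule (current g M)) (v : N).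
Variables (lam : hstar D) (chi : 'I_r -> regfun M -> K).
Hypothesis hwv : highest_weight_vector v lam chi.
Let N1 := restr_module N.

Lemma act_cartan (t : subvs_of h) c P : t = \sum_i c i *: hc i ->
  act (cur (vsval t) P) v = (\sum_i c i * chi i P) *: v.
Proof.
move=> ->; have [_ hv _] := hwv.
rewrite linear_sum /= cur_suml act_suml scaler_suml; apply: eq_bigr => i _.
by rewrite curZl actZl hv scalerA.
Qed.

Lemma highest_weight_weight : weight_space lam (v : N1).
Proof.
move=> t; have [c tc] := chev_h_span t; have [_ _ chi1] := hwv.
rewrite /= /restr_act (act_cartan _ tc) tc dual_comb; congr (_ *: _).
by apply: eq_bigr => i _; rewrite chi1.
Qed.

Section SimpleRoot.
Variable i : 'I_r.
Let F (Q : regfun M) (y : N) := act (cur (f i) Q) y.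
Let H (Q : regfun M) (y : N) := act (cur (vsval (hc i)) Q) y.
Let E (y : N) := act (cur (e i) 1) y.

Let HF Q R y : H Q (F R y) = F R (H Q y) - 2 *: F (Q * R) y.
Proof.
rewrite /H /F act_cur_comm (chev_fP i (hc i)) dualNE chev_hP curZl actZl.
by rewrite addrC scaleNr.
Qed.

Let EF R y : E (F R y) = H R y + F R (E y).
Proof. by rewrite /E /F act_cur_comm -chev_hE mul1r. Qed.

Lemma lowering_weight (Qs : seq (regfun M)) :
  weight_space (lam - alpha i *+ size Qs) (foldr F v Qs : N1).
Proof.
elim: Qs => [|Q Qs IH] /=; first by rewrite mulr0n subr0; exact: highest_weight_weight.
move=> t; rewrite /= /restr_act /F act_cur_comm (chev_fP i t) dualNE curZl actZl mul1r.
have := IH t; rewrite /= /restr_act => ->; rewrite actZr -scalerDl; congr (_ *: _).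
by rewrite !dualDE !dualNE !dualMnE mulrS opprD addrCA.
Qed.

(** A product of sufficiently many operators f_i (x) Q kills v, as its weight
    would not be a weight of the module. *)
Lemma lowering_nilpotent : integrable D N1 ->
  exists n, forall Qs : seq (regfun M), size Qs = n.+1 -> foldr F v Qs = 0.
Proof.
move=> /integrable_finite_weights[S SP].
have [|n] := @arith_progression_leaves K [seq ((mu : hstar D) (hc i) : K) | mu <- S] (lam (hc i)) (- 2).
  by rewrite oppr_eq0 pnatr_eq0.
move=> nS; exists n.
have z Qs : size Qs = n -> foldr F v Qs = 0.
  move=> sQ; apply: SP (lowering_weight Qs) _; apply: contra nS => muS.
  apply/mapP; exists (lam - alpha i *+ size Qs) => //.
  by rewrite sQ dualDE dualNE dualMnE chev_hP mulNrn.
by case=> // Q Qs [/z /= ->]; rewrite /F act0r.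
Qed.

Section Power.
Variable P : regfun M.
Hypothesis chiP : forall Q, chi i (P * Q) = 0.
Let Fs (s : seq nat) := foldr (fun a y => F (P ^+ a) y) v s.

(* Moving h_i (x) P^a to the right, where it kills v, multiplies the factors in
   turn by -2 P^a. *)
Let H_Fs a s : (0 < a)%N -> H (P ^+ a) (Fs s) = - 2 *: \sum_(t <- add_one a s) Fs t.
Proof.
case: a => // a _; elim: s => [|b s IH] /=.
  have [_ hv _] := hwv.
  by rewrite big_nil scaler0 /H /Fs /= hv exprS chiP scale0r.
rewrite big_cons big_map /= HF IH /F actZr act_sumr -exprD addnC.
by rewrite [RHS]scalerDr -scaleNr addrC.
Qed.

Let E_Fs s : all (leq 1) s -> E (Fs s) = - 2 *: \sum_(t <- merges s) Fs t.
Proof.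
elim: s => [_|a s IH /= /andP[a0 s0]] /=.
  have [nv _ _] := hwv.
  by rewrite big_nil scaler0 /E nv //; exact: n_plus_root_vector.
rewrite EF IH // H_Fs // big_cat big_map scalerDr /F actZr.
by rewrite act_sumr.
Qed.

(* All the coefficients have the same sign, hence do not cancel. *)
Let E_iter_Fs m s : size s = m.+1 -> all (leq 1) s ->
  exists2 c : nat, (0 < c)%N &
    iter m E (Fs s) = ((- 2) ^+ m * c%:R) *: F (P ^+ sumn s) v.
Proof.
elim: m s => [|m IH] s ss s0.
  case: s ss {s0} => [|a [|b s]] //= _; exists 1%N => //.
  by rewrite expr0 mul1r scale1r addn0.
rewrite iterSr E_Fs //.
have ED y z : iter m E (y + z) = iter m E y + iter m E z.
  by elim: m {IH ss} => //= m ->; rewrite /E actDr.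
have EZ c y : iter m E (c *: y) = c *: iter m E y.
  by elim: m {IH ss ED} => //= m ->; rewrite /E actZr.
have E0 : iter m E 0 = 0.
  by have := EZ 0 0; rewrite !scale0r.
have sum_pos (ts : seq (seq nat)) : {subset ts <= merges s} -> ts != [::] ->
    exists2 c : nat, (0 < c)%N & iter m E (\sum_(t <- ts) Fs t) =
      ((- 2) ^+ m * c%:R) *: F (P ^+ sumn s) v.
  elim: ts => // t ts IHt sub _.
  have [st tt tp] := mergesP (sub _ (mem_head _ _)).
  have [|c c0 cE] := IH t _ (tp s0).
    by move: st; rewrite ss => -[].
  rewrite big_cons ED cE tt; case: ts IHt sub => [|t2 ts] IHt sub.
    by exists c => //; rewrite big_nil E0 addr0.
  have [||d d0 ->] // := IHt; first by move=> z zt; apply: sub; rewrite inE zt orbT.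
  by exists (c + d)%N; rewrite ?ltn_addr // natrD mulrDr scalerDl.
have [|c c0 cE] := sum_pos (merges s) (fun _ => id).
  by case: s ss {s0 sum_pos} => [|a [|b s]].
by exists c => //; rewrite EZ cE scalerA exprS mulrA.
Qed.

(** The case of a list of n.+1 ones gives (f_i (x) P^(n.+1)) v = 0, and the action
    of h_i (x) Q then introduces an arbitrary factor Q. *)
Lemma lowering_power : integrable D N1 ->
  exists k, forall Q, act (cur (f i) (P ^+ k * Q)) v = 0.
Proof.
move=> /lowering_nilpotent[n nP].
have Fsn : Fs (nseq n.+1 1%N) = 0.
  have := nP (nseq n.+1 P); rewrite size_nseq => /(_ erefl) <-.
  by rewrite /Fs; elim: n.+1 => //= m ->; rewrite expr1.
have [||c c0] := @E_iter_Fs n (nseq n.+1 1%N).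
- by rewrite size_nseq.
- by rewrite all_nseq.
rewrite Fsn sumn_nseq mul1n => FP; have {FP} FP : F (P ^+ n.+1) v = 0.
  have E0 : iter n E 0 = 0 by elim: n {nP Fsn FP} => //= n ->; rewrite /E act0r.
  move/eqP: FP; rewrite E0 eq_sym scaler_eq0 mulf_eq0 expf_eq0 oppr_eq0.
  by rewrite !pnatr_eq0 andbF (gtn_eqF c0) /= => /eqP.
exists n.+1 => Q; have := HF Q (P ^+ n.+1) v; have [_ hv _] := hwv.
rewrite FP /H act0r hv /F actZr -/(F (P ^+ n.+1) v) FP scaler0 add0r => /eqP.
by rewrite eq_sym oppr_eq0 scaler_eq0 pnatr_eq0 /= mulrC => /eqP.
Qed.

End Power.
End SimpleRoot.

(** If every chi i vanishes on the ideal generated by P, then some power of P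
    kills the module. *)
Lemma power_annihilates P : integrable D N1 -> generated_by v ->
  (forall i Q, chi i (P * Q) = 0) ->
  exists k, forall x Q y, act (cur x (P ^+ k * Q)) (y : N) = 0.
Proof.
move=> intN gen chiP; have [nv _ _] := hwv.
pose S : set g := [set x | exists k, forall Q, act (cur x (P ^+ k * Q)) v = 0]%classic.
have le_pow (x : g) k k' (w : N) : (k <= k')%N ->
    (forall Q, act (cur x (P ^+ k * Q)) w = 0) ->
    forall Q, act (cur x (P ^+ k' * Q)) w = 0.
  by move=> kk' xk Q; rewrite -(subnK kk') addnC exprD -mulrA.
have sS : is_subspace S.
  split=> [|c x y [k xk] [l yl]]; first by exists 0%N => Q; rewrite cur0l act0l.
  exists (maxn k l) => Q; rewrite curDl curZl actDl actZl.
  rewrite (le_pow _ _ _ _ (leq_maxl k l) xk) (le_pow _ _ _ _ (leq_maxr k l) yl).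
  by rewrite scaler0 addr0.
have S_lie x y : S x -> S y -> S (lie x y).
  move=> [k xk] [l yl]; exists (k + l)%N => Q.
  rewrite exprD -mulrA -lie_cur act_lie yl act0r sub0r.
  by rewrite -[P ^+ k]mulr1 xk act0r oppr0.
have hS x : x \in h -> S x.
  move=> xh; exists 1%N => Q; have [c tc] := chev_h_span (vsproj h x).
  rewrite -(vsprojK xh) (act_cartan _ tc) big1 ?scale0r // => i _.
  by rewrite expr1 chiP mulr0.
have full : forall x, S x.
  apply: (stable_full sS hS) => i x; apply: S_lie.
  - by apply: hS; exact: subvsP.
  - exists 0%N => Q; apply: nv; exact: n_plus_root_vector.
  - by have [k kP] := lowering_power (chiP i) intN; exists k.
have [k kP] : exists k, forall x Q, act (cur x (P ^+ k * Q)) v = 0.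
  have /choice[k kP] : forall j : 'I_(\dim {:g}), exists k, forall Q,
      act (cur (vbasis {:g})`_j (P ^+ k * Q)) v = 0 by move=> j; exact: full.
  exists (\max_j k j)%N => x Q; rewrite (coord_vbasis (memvf x)) cur_suml act_suml.
  rewrite big1 // => j _; rewrite curZl actZl.
  by rewrite (le_pow _ _ _ _ (leq_bigmax j) (kP j)) scaler0.
exists k => x Q y; move: y x Q.
apply: (generated_ind (U := [set y | forall x Q, act (cur x (P ^+ k * Q)) y = 0]%classic) gen).
  apply: cur_submodule => [|x R y yP z Q].
    split=> [x Q|c y z yP zP x Q]; first exact: act0r.
    by rewrite actDr actZr yP zP scaler0 addr0.
  by rewrite act_cur_comm yP act0r addr0 -mulrA yP.
exact: kP.
Qed.

End HighestWeight.

(** * Submodules and twisted modules *)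

Section Submodule.
Variables (K : fieldType) (L : lieAlgType K) (N : lieModule L) (U : set N).

(** A submodule as a module in its own right.  The carrier takes the proof of
    being a submodule as an argument, on which its module structure depends. *)
Definition submodule_sort of is_submodule U : Type := {y : N | `[< U y >]}.

Variable subU : is_submodule U.
Local Notation T := (submodule_sort subU).

HB.instance Definition _ := Choice.on T.

Let sU : is_subspace U := subU.1.
Definition submodule_in (y : N) (Uy : U y) : T := exist _ y (asboolT Uy).
Definition submodule_val (a : T) : N := val a.

Lemma submodule_valP a : U (submodule_val a).
Proof. by apply/asboolP; case: a. Qed.
Lemma submodule_val_inj : injective submodule_val. Proof. exact: val_inj. Qed.

Definition submodule_zero : T := submodule_in (subspace0 sU).
Definition submodule_add (a b : T) : T :=
  submodule_in (subspaceD sU (submodule_valP a) (submodule_valP b)).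
Definition submodule_scale c (a : T) : T :=
  submodule_in (subspaceZ sU c (submodule_valP a)).
Definition submodule_opp (a : T) : T := submodule_scale (-1) a.

Fact submodule_addA : associative submodule_add.
Proof. by move=> a b c; apply: val_inj; exact: addrA. Qed.
Fact submodule_addC : commutative submodule_add.
Proof. by move=> a b; apply: val_inj; exact: addrC. Qed.
Fact submodule_add0 : left_id submodule_zero submodule_add.
Proof. by move=> a; apply: val_inj; exact: add0r. Qed.
Fact submodule_addN : left_inverse submodule_zero submodule_opp submodule_add.
Proof. by move=> a; apply: val_inj => /=; rewrite -[submodule_val (submodule_opp a)]/(-1 *: submodule_val a) scaleN1r addNr. Qed.
HB.instance Definition _ := GRing.isZmodule.Build T
  submodule_addA submodule_addC submodule_add0 submodule_addN.

Fact submodule_scaleA a b (y : T) :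
  submodule_scale a (submodule_scale b y) = submodule_scale (a * b) y.
Proof. by apply: val_inj; exact: scalerA. Qed.
Fact submodule_scale1 : left_id 1 submodule_scale.
Proof. by move=> y; apply: val_inj; exact: scale1r. Qed.
Fact submodule_scaleDr : right_distributive submodule_scale +%R.
Proof. by move=> a y z; apply: val_inj; exact: scalerDr. Qed.
Fact submodule_scaleDl y : {morph submodule_scale^~ y : a b / a + b}.
Proof. by move=> a b; apply: val_inj; exact: scalerDl. Qed.
HB.instance Definition _ := GRing.Zmodule_isLmodule.Build K T
  submodule_scaleA submodule_scale1 submodule_scaleDr submodule_scaleDl.

Definition submodule_act (x : L) (a : T) : T :=
  submodule_in (subU.2 x _ (submodule_valP a)).

Fact submodule_act_bilinear : bilinear_for *:%R *:%R submodule_act.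
Proof.
split=> [a|x] c y z; apply: val_inj => /=.
  by rewrite actDl actZl.
by rewrite actDr actZr.
Qed.

Fact submodule_act_lie x y a : submodule_act (lie x y) a =
  submodule_act x (submodule_act y a) - submodule_act y (submodule_act x a).
Proof. by apply: val_inj => /=; rewrite act_lie; congr (_ + _); rewrite -scaleN1r. Qed.

Definition submodule : lieModule L :=
  LieModule submodule_act_bilinear submodule_act_lie.

Lemma submodule_val_act x (a : submodule) :
  submodule_val (act x a) = act x (submodule_val a).
Proof. by []. Qed.

Lemma submodule_val_sum (I : Type) (s : seq I) (F : I -> submodule) :
  submodule_val (\sum_(i <- s) F i) = \sum_(i <- s) submodule_val (F i).
Proof. by elim/big_rec2: _ => // i _ y _ <-. Qed.

End Submodule.

Section CyclicSubmodule.
Variables (K : fieldType) (L : lieAlgType K) (N : lieModule L) (v : N).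

(** The submodule generated by v. *)
Definition cyclic_set : set N := smallest (@is_submodule _ _ N) [set v]%classic.

Lemma cyclic_set_submodule : is_submodule cyclic_set.
Proof.
split; last by move=> x y vy U [sU vU]; apply: sU.2; exact: vy.
split=> [U [[sU _] _]|c x y vx vy U vU]; first exact: subspace0.
by have [[sU _] _] := vU; apply: sU.2; [exact: vx | exact: vy].
Qed.

Lemma cyclic_set_gen : cyclic_set v. Proof. by move=> U [_]; apply. Qed.

Lemma cyclic_set_min (U : set N) : is_submodule U -> U v -> forall y, cyclic_set y -> U y.
Proof. by move=> sU Uv y; apply; split=> // _ ->. Qed.

Definition cyclic_submodule : lieModule L := submodule cyclic_set_submodule.
Definition cyclic_vector : cyclic_submodule :=
  submodule_in cyclic_set_submodule cyclic_set_gen.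

Lemma cyclic_submodule_generated : generated_by cyclic_vector.
Proof.
rewrite /generated_by -subTset => a _ U [subU Uv].
pose V : set N := [set y | exists2 b : cyclic_submodule, submodule_val b = y & U b]%classic.
have subV : is_submodule V.
  split; first split.
  - by exists 0 => //; exact: (subspace0 subU.1).
  - move=> c _ _ [b <- Ub] [d <- Ud]; exists (c *: b + d) => //.
    exact: subU.1.2.
  - by move=> x _ [b <- Ub]; exists (act x b) => //; exact: subU.2.
have Vv : V v by exists cyclic_vector => //; exact: Uv.
have [b ba Ub] := cyclic_set_min subV Vv (submodule_valP a).
by rewrite -(submodule_val_inj ba).
Qed.

End CyclicSubmodule.

Section Twist.
Variables (K : fieldType) (g : lieAlgType K) (M : affineVariety K).
Variables (N : lieModule (current g M)) (eps : regfun M).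

(** The linear endomorphism of the current algebra taking x (x) P to
    x (x) eps P. *)
Definition twist_map : current g M -> current g M :=
  tensor_lift (fun x P => cur x (eps * P)).

Fact twist_map_bilinear :
  bilinear_for *:%R *:%R (fun (x : g) P => cur x (eps * P)).
Proof.
split=> [P|x] c y z; first by rewrite curDl curZl.
by rewrite mulrDr curDr -regfun_scaleAr (bilZr (cur_bilinear _ _)).
Qed.

Lemma twist_map_linear : linear twist_map.
Proof. exact: tensor_lift_linear twist_map_bilinear. Qed.

Lemma twist_map_cur x P : twist_map (cur x P) = cur x (eps * P).
Proof. exact: tensor_lift_tens twist_map_bilinear. Qed.

Lemma twist_mapD s t : twist_map (s + t) = twist_map s + twist_map t.
Proof. by have := twist_map_linear 1 s t; rewrite !scale1r. Qed.

Lemma twist_map0 : twist_map 0 = 0.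
Proof. exact: linear_zero twist_map_linear. Qed.

Hypothesis eps_idem : forall x P (y : N), act (cur x (eps * (1 - eps) * P)) y = 0.

Definition twist_act s (y : N) : N := act (twist_map s) y.

Fact twist_act_bilinear : bilinear_for *:%R *:%R twist_act.
Proof.
split=> [y|s] c a b; rewrite /twist_act.
  by rewrite twist_map_linear actDl actZl.
by rewrite actDr actZr.
Qed.

Lemma act_twist_lie s t (y : N) : act (twist_map (lie s t)) y = act (lie (twist_map s) (twist_map t)) y.
Proof.
have bl := @lie_bilinear _ (current g M).
elim/current_ind: s => [|x P s IH]; first by rewrite twist_map0 !(bil0l bl) twist_map0.
rewrite twist_mapD !(bilDl bl) twist_mapD !actDl IH; congr (_ + _) => {s IH}.
elim/current_ind: t => [|z Q t IH]; first by rewrite twist_map0 !(bil0r bl) twist_map0.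
rewrite twist_mapD !(bilDr bl) twist_mapD !actDl IH; congr (_ + _) => {t IH}.
rewrite lie_cur !twist_map_cur lie_cur; apply/eqP; rewrite -subr_eq0 -actNl -actDl.
rewrite -curNr -curDr; apply/eqP; rewrite -[RHS](eps_idem (lie x z) (P * Q) y).
by congr (act (cur _ _) _); rewrite mulrBr mulr1 mulrBl mulrACA.
Qed.

Fact twist_act_lie s t y :
  twist_act (lie s t) y = twist_act s (twist_act t y) - twist_act t (twist_act s y).
Proof. by rewrite /twist_act act_twist_lie act_lie. Qed.

(** The module on which x (x) P acts as x (x) eps P does on N, for a
    function eps which is idempotent as far as N is concerned. *)
Definition twist_module : lieModule (current g M) :=
  LieModule twist_act_bilinear twist_act_lie.

Lemma act_twist x P (y : twist_module) :
  act (cur x P) y = act (cur x (eps * P)) (y : N).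
Proof. by rewrite /= /twist_act twist_map_cur. Qed.

End Twist.

(** * Regular functions separating finite sets of points *)

Section Interpolation.
Variables (K : fieldType) (M : affineVariety K).
Implicit Types (P Q : regfun M) (z : set_type M).

Lemma regfunE1 z : (1 : regfun M) z = 1. Proof. by []. Qed.
Lemma regfunED P Q z : (P + Q) z = P z + Q z. Proof. by []. Qed.
Lemma regfunEN P z : (- P) z = - P z. Proof. by []. Qed.
Lemma regfunEM P Q z : (P * Q) z = P z * Q z :> K. Proof. by []. Qed.
Lemma regfunEZ (c : K) P z : (c *: P) z = c * P z :> K. Proof. by []. Qed.
Lemma regfunEX P n z : (P ^+ n) z = P z ^+ n :> K.
Proof. by elim: n => // n IH; rewrite !exprS regfunEM IH. Qed.
Lemma regfunE_prod (I : Type) (s : seq I) (F : I -> regfun M) z :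
  (\prod_(i <- s) F i) z = \prod_(i <- s) F i z :> K.
Proof. by elim/big_rec2: _ => // i _ y _ <-. Qed.

Lemma coordinate_regular (l : 'I_(ambient_dim M)) :
  regular (fun z : set_type M => val z l : K^o).
Proof.
by apply/asboolP; exists (mpoly.mpolyX K (mpoly.mnm1 l)) => z; rewrite mpoly.mevalXU.
Qed.

Lemma separate_points z z' : z <> z' -> exists P, P z = 0 /\ P z' = 1 :> K.
Proof.
move=> zz'; have [l zl] : exists l, val z l != val z' l.
  apply: contrapT => nex; apply: zz'; apply: val_inj; apply/funext => l.
  by apply/eqP; apply: contrapT => /negP zl; apply: nex; exists l.
pose X := RegFun (coordinate_regular l).
exists ((val z' l - val z l)^-1 *: (X - val z l *: (1 : regfun M))).
rewrite !regfunEZ !regfunED !regfunEN !regfunEZ !regfunE1 !mulr1 /= subrr mulr0.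
by rewrite mulVf // subr_eq0 eq_sym.
Qed.

Lemma separate_finite_sets (I J : finType) (z : I -> set_type M) (z' : J -> set_type M) :
  (forall i j, z i <> z' j) ->
  exists P, (forall i, P (z i) = 0 :> K) /\ (forall j, P (z' j) = 1 :> K).
Proof.
move=> zz'; have /choice[F FP] : forall p : I * J, exists P,
    P (z p.1) = 0 /\ P (z' p.2) = 1 :> K by move=> p; exact: separate_points.
exists (1 - \prod_j (1 - \prod_i F (i, j))); split=> [i|j].
  rewrite regfunED regfunEN regfunE_prod big1 ?subrr // => j _.
  rewrite regfunED regfunEN regfunE_prod (bigD1 i) //= (FP (i, j)).1.
  by rewrite mul0r oppr0 addr0.
have F1 : \prod_i F (i, j) (z' j) = 1 :> K.
  by apply: big1 => i _; rewrite (FP (i, j)).2.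
rewrite regfunED regfunEN regfunE_prod (bigD1 j) // regfunED regfunEN regfunE_prod.
by rewrite F1 regfunE1 subrr [X in - X]mul0r oppr0 addr0.
Qed.

Lemma one_sub_pow_dvd P k : exists Q, 1 - (1 - P) ^+ k = P * Q.
Proof.
elim: k => [|k [Q QE]]; first by exists 0; rewrite expr0 subrr mulr0.
exists (Q + (1 - P) ^+ k); rewrite mulrDr -QE exprS mulrBl mul1r opprB.
by rewrite [X in _ + X = _]addrC addrA.
Qed.

End Interpolation.

(** * Tensor products and twists of highest weight modules *)

Section WeylModules.
Variables (K : numClosedFieldType) (g : finLieAlgType K) (D : chevalleyData g).
Variable M : affineVariety K.
Local Notation h := (cartan D).
Local Notation r := (\dim (cartan D)).
Local Notation hc := (chev_h D).

Lemma integrable_of_span (V : lieModule g) (S : seq (hstar D)) :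
  (forall mu, mu \in S -> weight_lattice mu) ->
  (forall v : V, lspan [set w | exists2 mu, mu \in S & weight_space mu w]%classic v) ->
  integrable D V.
Proof.
move=> SP spn; apply: (integrable_of_decomposition SP) => v.
pose U : set V := [set w | exists2 u : hstar D -> V,
  forall mu, mu \in S -> weight_space mu (u mu) & w = \sum_(mu <- undup S) u mu]%classic.
apply: (lspan_min (U := U) _ _ (spn v)) => [|w [mu muS wmu]].
  split=> [|c _ _ [u uw ->] [u' u'w ->]].
    by exists (fun=> 0) => [mu _ t|]; rewrite ?act0r ?scaler0 // big1.
  exists (fun mu => c *: u mu + u' mu) => [mu muS t|].
    by rewrite actDr actZr uw // u'w // scalerDr !scalerA mulrC.
  by rewrite scaler_sumr -big_split.
exists (fun nu => if nu == mu then w else 0) => [nu nuS|].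
  by case: eqP => [->|_ t] //; rewrite act0r scaler0.
rewrite (bigD1_seq mu) ?mem_undup ?undup_uniq //= eqxx big1 ?addr0 // => nu /negPf.
by move->.
Qed.

(** The scalar by which h_i (x) P acts on the generator of a local Weyl module:
    the sum of the values of P at the points with index i. *)
Definition eval_sum (lam : dominantWeight D) (Z : multiset M lam) (i : 'I_r)
    (P : regfun M) : K := \sum_(j < dw_coef lam i) P (tnth (Z i) j).

Section EvalSum.
Variables (lam : dominantWeight D) (Z : multiset M lam).

Lemma eval_sum1 i (P : regfun M) :
  (forall i j, P (tnth (Z i) j) = 1 :> K) -> eval_sum Z i P = (lam : hstar D) (hc i).
Proof.
move=> P1; rewrite dw_coefP /eval_sum (eq_bigr (fun=> 1)) => [|j _]; last exact: P1.
by rewrite sumr_const card_ord.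
Qed.

Lemma eval_sum0 i (P : regfun M) :
  (forall i j, P (tnth (Z i) j) = 0 :> K) -> eval_sum Z i P = 0.
Proof. by move=> P0; apply: big1 => j _; exact: P0. Qed.

Lemma eval_sum_ext i (P Q : regfun M) :
  (forall i j, P (tnth (Z i) j) = Q (tnth (Z i) j) :> K) ->
  eval_sum Z i P = eval_sum Z i Q.
Proof. by move=> PQ; apply: eq_bigr => j _; exact: PQ. Qed.

Lemma eval_sum_union (lam' : dominantWeight D) (Z' : multiset M lam') i P :
  eval_sum (multiset_union Z Z') i P = eval_sum Z i P + eval_sum Z' i P.
Proof.
rewrite /eval_sum /= big_split_ord; congr (_ + _); apply: eq_bigr => j _.
  by rewrite tnth_lshift.
by rewrite tnth_rshift.
Qed.

Lemma weyl_cyclic_highest_weight (N : lieModule (current g M)) (v : N) :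
  weyl_cyclic Z v -> highest_weight_vector v (lam : hstar D) (eval_sum Z).
Proof. by move=> [_ _ nv hv]; split=> // i; exact: eval_sum1. Qed.

Lemma weyl_cyclic_annihilator (N : lieModule (current g M)) (v : N) (P : regfun M) :
  weyl_cyclic Z v -> (forall i j, P (tnth (Z i) j) = 0 :> K) ->
  exists k, forall x Q y, act (cur x (P ^+ k * Q)) (y : N) = 0.
Proof.
move=> wv P0; have hwv := weyl_cyclic_highest_weight wv; have [intN gen _ _] := wv.
apply: (power_annihilates hwv intN gen) => i Q; apply: eval_sum0 => i' j.
by rewrite regfunEM P0 mul0r.
Qed.

End EvalSum.

Section TensorProduct.
Variables (lam1 lam2 : dominantWeight D) (Z1 : multiset M lam1) (Z2 : multiset M lam2).
Variables (W1 W2 : lieModule (current g M)) (w1 : W1) (w2 : W2).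
Hypotheses (cyc1 : weyl_cyclic Z1 w1) (cyc2 : weyl_cyclic Z2 w2).
Local Notation T := (tensor_module W1 W2).

Let bt := tens_bilinear W1 W2.

Lemma act_tens s a b : act s (tens a b : T) = tens (act s a) b + tens a (act s b).
Proof. exact: tensor_act_tens. Qed.

Lemma tensor_integrable : integrable D (restr_module T).
Proof.
have [[S1 [_ lat1 dec1 _]] _ _ _] := cyc1; have [[S2 [_ lat2 dec2 _]] _ _ _] := cyc2.
pose S := [seq (mu : hstar D) + nu | mu <- S1, nu <- S2].
apply: (@integrable_of_span _ S) => [_ /allpairsP[[mu nu] /= [muS nuS ->]] i|v].
  have [m mE] := lat1 _ muS i; have [n nE] := lat2 _ nuS i.
  by exists (m + n); rewrite dualDE mE nE rmorphD.
have sX := lspan_subspace (K := K) (V := T)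
  [set w : restr_module T | exists2 mu, mu \in S & weight_space mu w]%classic.
move: v; apply: tensor_ind => [|a b x Hx]; first exact: (subspace0 sX).
apply: (subspaceD sX) => //.
have [u uw ->] := dec1 a; have [u' u'w ->] := dec2 b.
have -> : tens (\sum_(mu <- S1) u mu) (\sum_(nu <- S2) u' nu) =
    \sum_(mu <- S1) \sum_(nu <- S2) tens (u mu) (u' nu).
  have -> : tens (\sum_(mu <- S1) u mu) (\sum_(nu <- S2) u' nu) =
    \sum_(mu <- S1) tens (u mu) (\sum_(nu <- S2) u' nu).
    by elim/big_rec2: _ => [|mu y z _ <-]; rewrite ?(bil0l bt) ?(bilDl bt).
  apply: eq_bigr => mu _.
  by elim/big_rec2: _ => [|nu y z _ <-]; rewrite ?(bil0r bt) ?(bilDr bt).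
rewrite big_seq; apply: (subspace_sum sX) => mu muS.
rewrite big_seq; apply: (subspace_sum sX) => nu nuS.
apply: sub_lspan; exists (mu + nu); first by apply/allpairsP; exists (mu, nu).
move=> t; have := uw _ muS t; have := u'w _ nuS t; rewrite /= /restr_act => nuE muE.
by rewrite tensor_act_tens muE nuE (bilZl bt) (bilZr bt) -scalerDl dualDE.
Qed.

Variables e1 e2 : regfun M.
Hypothesis e12 : e1 + e2 = 1.
Hypothesis kill1 : forall x Q y, act (cur x (e2 * Q)) (y : W1) = 0.
Hypothesis kill2 : forall x Q y, act (cur x (e1 * Q)) (y : W2) = 0.

Lemma act_e1 x Q (y : W1) : act (cur x (e1 * Q)) y = act (cur x Q) y.
Proof.
by rewrite -[in RHS](mul1r Q) -e12 mulrDl curDr actDl kill1 addr0.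
Qed.

Lemma act_e2 x Q (y : W2) : act (cur x (e2 * Q)) y = act (cur x Q) y.
Proof.
by rewrite -[in RHS](mul1r Q) -e12 mulrDl curDr actDl kill2 add0r.
Qed.

Lemma tensor_generated : generated_by (tens w1 w2 : T).
Proof.
rewrite /generated_by -subTset => t _ U [subU Uw].
have {}Uw : U (tens w1 w2) by exact: Uw.
have [_ gen1 _ _] := cyc1; have [_ gen2 _ _] := cyc2.
have U1 a : U (tens a w2).
  apply: (generated_ind (U := [set a | U (tens a w2)]%classic) gen1) => //.
  apply: cur_submodule => [|x P b Ub] /=.
    split=> [|c a1 a2 Ua1 Ua2]; rewrite /= ?(bil0l bt); first exact: (subspace0 subU.1).
    by rewrite (bilDl bt) (bilZl bt); exact: subU.1.2.
  have := subU.2 (cur x (e1 * P)) _ Ub.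
  by rewrite act_tens kill2 (bil0r bt) addr0 act_e1.
have U2 a b : U (tens a b).
  apply: (generated_ind (U := [set b | U (tens a b)]%classic) gen2) => //.
  apply: cur_submodule => [|x P c Uc] /=.
    split=> [|c b1 b2 Ub1 Ub2]; rewrite /= ?(bil0r bt); first exact: (subspace0 subU.1).
    by rewrite (bilDr bt) (bilZr bt); exact: subU.1.2.
  have := subU.2 (cur x (e2 * P)) _ Uc.
  by rewrite act_tens kill1 (bil0l bt) add0r act_e2.
move: t; apply: tensor_ind => [|a b x Ux]; first exact: (subspace0 subU.1).
by apply: (subspaceD subU.1); first exact: U2.
Qed.

(** When x (x) P acts on the first factor as x (x) e1 P, and on the second one
    as x (x) e2 P, the tensor product is cyclic. *)
Lemma tensor_weyl_cyclic : weyl_cyclic (multiset_union Z1 Z2) (tens w1 w2 : T).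
Proof.
have [_ _ n1 h1] := cyc1; have [_ _ n2 h2] := cyc2; split.
- exact: tensor_integrable.
- exact: tensor_generated.
- by move=> x P xn; rewrite act_tens n1 // n2 // (bil0l bt) (bil0r bt) addr0.
- move=> P i; rewrite act_tens h1 h2 (bilZl bt) (bilZr bt) -scalerDl.
  by rewrite -[X in _ = X *: _]/(eval_sum _ i P) eval_sum_union.
Qed.

End TensorProduct.

Section TwistedCyclic.
Variables (lam1 lam2 : dominantWeight D) (Z1 : multiset M lam1) (Z2 : multiset M lam2).
Variables (W : lieModule (current g M)) (w : W).
Hypothesis intW : integrable D (restr_module W).
Hypothesis hw : highest_weight_vector w ((lam1 : hstar D) + (lam2 : hstar D))
  (fun i P => eval_sum Z1 i P + eval_sum Z2 i P).
Variable eps : regfun M.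
Hypothesis eps1 : forall i j, eps (tnth (Z1 i) j) = 1 :> K.
Hypothesis eps0 : forall i j, eps (tnth (Z2 i) j) = 0 :> K.
Hypothesis eps_idem : forall x P (y : W), act (cur x (eps * (1 - eps) * P)) y = 0.

Let Tw := twist_module eps_idem.
Let C := cyclic_set (w : Tw).

(** On the submodule generated by w in the twisted module, h (x) (1 - eps)
    acts by a character, so that the actions of h (x) 1 and h (x) eps differ
    by scalars. *)
Lemma act_one_sub_eps t y : C y ->
  act (cur (vsval (t : subvs_of h)) (1 - eps)) (y : W) = (lam2 : hstar D) t *: y.
Proof.
pose U : set Tw := [set y : Tw | forall t : subvs_of h,
  act (cur (vsval t) (1 - eps)) (y : W) = (lam2 : hstar D) t *: (y : W)]%classic.
move=> Cy; suff : U y by apply.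
apply: cyclic_set_min Cy.
  apply: (@cur_submodule _ _ _ Tw) => [|x P z zP s].
    split=> [s|c a b aP bP s]; first by rewrite act0r scaler0.
    by rewrite actDr actZr aP bP scalerDr !scalerA mulrC.
  rewrite act_twist act_cur_comm zP actZr mulrA [(1 - eps) * eps]mulrC.
  by rewrite eps_idem add0r.
move=> s /=; have [c tc] := chev_h_span s.
rewrite (act_cartan hw _ tc); congr (_ *: _); rewrite [in RHS]tc dual_comb.
apply: eq_bigr => i _; congr (_ * _).
rewrite eval_sum0 ?add0r => [|i' j]; last first.
  by rewrite regfunED regfunEN regfunE1 eps1 subrr.
by apply: eval_sum1 => i' j; rewrite regfunED regfunEN regfunE1 eps0 subr0.
Qed.

Lemma act_cartan_one t y : C y -> act (cur (vsval (t : subvs_of h)) 1) (y : W) =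
  act (cur (vsval t) eps) (y : W) + (lam2 : hstar D) t *: y.
Proof.
by move=> Cy; rewrite -act_one_sub_eps // -actDl -curDr addrC subrK.
Qed.

Lemma twisted_cyclic_integrable : integrable D (restr_module (cyclic_submodule (w : Tw))).
Proof.
have subC := cyclic_set_submodule (w : Tw).
have [S [uS lat dec _]] := intW.
apply: (@integrable_of_span _ [seq (mu : hstar D) - (lam2 : hstar D) | mu <- S]).
  move=> _ /mapP[mu muS ->] i; have [m mE] := lat _ muS i.
  by exists (m - (dw_coef lam2 i)%:Z); rewrite dualDE dualNE mE dw_coefP rmorphB.
move=> c; have Cc : C (submodule_val c) := submodule_valP c.
have [u uw cE] := dec (submodule_val c).
have Cu mu : mu \in S -> C (u mu).
  apply: (@weight_components K g D (restr_module W) C S u subC.1) => //; last first.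
    by rewrite -cE.
  move=> t y Cy; rewrite /= /restr_act act_cartan_one // -[eps]mulr1.
  rewrite -act_twist; apply: (subspaceD subC.1); first exact: subC.2.
  exact: (subspaceZ subC.1).
pose u' mu : cyclic_submodule (w : Tw) :=
  if pselect (C (u mu)) is left Cmu then submodule_in subC Cmu else 0.
have u'E mu : mu \in S -> submodule_val (u' mu) = u mu.
  by move=> muS; rewrite /u'; case: pselect => // nC; case: nC; exact: Cu.
have -> : c = \sum_(mu <- S) u' mu.
  apply: submodule_val_inj; rewrite submodule_val_sum cE.
  by apply: eq_big_seq => mu muS; rewrite u'E.
have sX := lspan_subspace (K := K) (V := cyclic_submodule (w : Tw))
  [set w : restr_module (cyclic_submodule (w : Tw)) |
    exists2 mu, mu \in [seq (mu : hstar D) - (lam2 : hstar D) | mu <- S] &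
      weight_space mu w]%classic.
rewrite big_seq; apply: (subspace_sum sX) => mu muS; apply: sub_lspan.
exists (mu - (lam2 : hstar D)); first by apply/mapP; exists mu.
move=> t; apply: submodule_val_inj; rewrite /= /restr_act submodule_val_act.
rewrite -[RHS]/(_ *: submodule_val (u' mu)) u'E // act_twist mulr1.
have := act_cartan_one t (Cu _ muS); have := uw _ muS t; rewrite /= /restr_act => ->.
by rewrite dualDE dualNE scalerBl => /esym/(canRL (addrK _)).
Qed.

Lemma twisted_cyclic_weyl_cyclic : weyl_cyclic Z1 (cyclic_vector (w : Tw)).
Proof.
have [nw hw' _] := hw; split.
- exact: twisted_cyclic_integrable.
- exact: cyclic_submodule_generated.
- move=> x P xn; apply: submodule_val_inj; rewrite submodule_val_act.
  by rewrite act_twist nw.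
- move=> P i; apply: submodule_val_inj; rewrite submodule_val_act.
  rewrite act_twist hw'; congr (_ *: _).
  rewrite (eval_sum0 (Z := Z2)) ?addr0 => [|i' j]; last by rewrite regfunEM eps0 mul0r.
  by apply: eval_sum_ext => i' j; rewrite regfunEM eps1 mul1r.
Qed.

Lemma twisted_hom (W1 : lieModule (current g M)) (w1 : W1) : is_local_weyl Z1 w1 ->
  exists p : W1 -> W, [/\ linear p, p w1 = w &
    forall x Q a, p (act (cur x Q) a) = act (cur x (eps * Q)) (p a)].
Proof.
move=> [_ /(_ _ _ twisted_cyclic_weyl_cyclic)[p [hp pw _]]].
exists (fun a => submodule_val (p a)); split.
- by move=> c a b; rewrite linearP.
- by rewrite pw.
- by move=> x Q a; rewrite hp submodule_val_act act_twist.
Qed.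

End TwistedCyclic.
End WeylModules.

(** * The isomorphism *)

Section Factorization.
Variables (K : numClosedFieldType) (g : finLieAlgType K) (D : chevalleyData g).
Variables (M : affineVariety K) (lam lam' : dominantWeight D).
Variables (Z : multiset M lam) (Z' : multiset M lam').
Variables (W W1 W2 : lieModule (current g M)) (w : W) (w1 : W1) (w2 : W2).
Hypothesis disjZ : forall i j i' j', tnth (Z i) j <> tnth (Z' i') j'.
Hypothesis hW : is_local_weyl (multiset_union Z Z') w.
Hypotheses (hW1 : is_local_weyl Z w1) (hW2 : is_local_weyl Z' w2).

(** There is a regular function p, equal to 0 on Z and to 1 on Z', such that p
    is idempotent for the action on W while p and 1 - p kill W1 and W2
    respectively. *)
Lemma separating_function : exists p : regfun M,
  [/\ forall i j, p (tnth (Z i) j) = 0 :> K, forall i j, p (tnth (Z' i) j) = 1 :> K,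
      forall x Q y, act (cur x (p * (1 - p) * Q)) (y : W) = 0,
      forall x Q y, act (cur x (p * Q)) (y : W1) = 0 &
      forall x Q y, act (cur x ((1 - p) * Q)) (y : W2) = 0].
Proof.
have [] := @separate_finite_sets K M {i : 'I_(lrank D) & 'I_(dw_coef lam i)}
  {i : 'I_(lrank D) & 'I_(dw_coef lam' i)} (fun s => tnth (Z (tag s)) (tagged s))
  (fun s => tnth (Z' (tag s)) (tagged s)).
  by move=> s s'; exact: disjZ.
move=> P [P0 P1].
have {}P0 i j : P (tnth (Z i) j) = 0 := P0 (Tagged (fun i => 'I_(dw_coef lam i)) j).
have {}P1 i j : P (tnth (Z' i) j) = 1 := P1 (Tagged (fun i => 'I_(dw_coef lam' i)) j).
have [k1 kill1] := weyl_cyclic_annihilator hW1.1 P0.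
have [|k2 kill2] := weyl_cyclic_annihilator (P := 1 - P) hW2.1.
  by move=> i j; rewrite regfunED regfunEN P1 regfunE1 subrr.
have [|k3 kill3] := weyl_cyclic_annihilator (P := P * (1 - P)) hW.1.
  move=> i j; rewrite regfunEM regfunED regfunEN regfunE1.
  case: (split_ordP j) => j' ->; rewrite ?tnth_lshift ?tnth_rshift.
    by rewrite P0 mul0r.
  by rewrite P1 subrr mulr0.
pose k := (k1 + k2 + k3).+1.
have [S SE] := one_sub_pow_dvd P k; have [S' S'E] := one_sub_pow_dvd ((1 - P) ^+ k) k.
pose p := (1 - (1 - P) ^+ k) ^+ k.
have pE : p = P ^+ k * S ^+ k by rewrite /p SE exprMn.
have split_pow (Q : regfun M) l : (l <= k)%N -> Q ^+ k = Q ^+ l * Q ^+ (k - l).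
  by move=> lk; rewrite -exprD subnKC.
have [lk1 lk2 lk3] : [/\ k1 <= k, k2 <= k & k3 <= k]%N.
  by rewrite /k; split; lia.
exists p; split=> [i j|i j|x Q y|x Q y|x Q y].
- by rewrite /p regfunEX regfunED regfunEN regfunEX regfunED regfunEN regfunE1 P0
    subr0 expr1n subrr expr0n.
- by rewrite /p regfunEX regfunED regfunEN regfunEX regfunED regfunEN regfunE1 P1
    subrr expr0n /= subr0 expr1n.
- rewrite S'E {1}pE mulrACA -exprMn (split_pow (P * (1 - P)) _ lk3) -!mulrA. exact: kill3.
- rewrite pE (split_pow P _ lk1) -!mulrA; exact: kill1.
- rewrite S'E (split_pow (1 - P) _ lk2) -!mulrA; exact: kill2.
Qed.

(** A homomorphism out of a cyclic module into a twist of W is determined by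
    the image of the generator. *)
Lemma twisted_hom_unique (eps : regfun M) (p q : W1 -> W) : linear p -> linear q ->
  (forall x Q a, p (act (cur x Q) a) = act (cur x (eps * Q)) (p a)) ->
  (forall x Q a, q (act (cur x Q) a) = act (cur x (eps * Q)) (q a)) ->
  p w1 = q w1 -> p =1 q.
Proof.
move=> lp lq hp hq pq a; have [[_ gen _ _] _] := hW1.
apply: (generated_ind (U := [set a | p a = q a]%classic) gen) => //.
apply: cur_submodule => [|x Q b /= bpq]; last by rewrite hp hq bpq.
split=> [|c b1 b2 /= e1 e2]; first by rewrite /= !linear_zero.
by rewrite lp lq e1 e2.
Qed.

Lemma weyl_tensor_isomorphism : module_isomorphic W (tensor_module W1 W2).
Proof.
have [p [p0 p1 killW kill1 kill2]] := separating_function.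
pose q := 1 - p; have qp : q + p = 1 by rewrite subrK.
have qC : 1 - q = p by rewrite opprB addrC subrK.
have killWq x Q (y : W) : act (cur x (q * (1 - q) * Q)) y = 0.
  by rewrite qC mulrC [q * p]mulrC mulrC killW.
have [cycW univW] := hW; have [intW genW _ _] := cycW.
have hwW := weyl_cyclic_highest_weight cycW.
have [f1 [lf1 f1w hf1]] : exists f1 : W1 -> W, [/\ linear f1, f1 w1 = w &
    forall x Q a, f1 (act (cur x Q) a) = act (cur x (q * Q)) (f1 a)].
  apply: (@twisted_hom _ _ _ _ lam lam' Z Z' W w intW _ q _ _ killWq _ _ hW1).
  - have [nw hw h1] := hwW; split=> // [P i|i]; first by rewrite hw eval_sum_union.
    by rewrite -h1 eval_sum_union.
  - by move=> i j; rewrite regfunED regfunEN p0 regfunE1 subr0.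
  - by move=> i j; rewrite regfunED regfunEN p1 regfunE1 subrr.
have [f2 [lf2 f2w hf2]] : exists f2 : W2 -> W, [/\ linear f2, f2 w2 = w &
    forall x Q a, f2 (act (cur x Q) a) = act (cur x (p * Q)) (f2 a)].
  apply: (@twisted_hom _ _ _ _ lam' lam Z' Z W w intW _ p p1 p0 killW _ _ hW2).
  have [nw hw h1] := hwW; split=> // [P i|i].
    by rewrite hw eval_sum_union addrC.
  by rewrite -[in RHS](addrC (lam : hstar D)) -h1 eval_sum_union addrC.
have comm x Q y R (z : W) : act (cur x (q * Q)) (act (cur y (p * R)) z) =
    act (cur y (p * R)) (act (cur x (q * Q)) z).
  by rewrite act_cur_comm mulrACA [q * p]mulrC killW add0r.
have [_ gen2 _ _] := hW2.1.
(* For each b there is a homomorphism from W1 to the twist of W by q which maps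
   the generator to f2 b; these b form a submodule, since the actions on W of
   the two twists commute. *)
have /choice[B BP] : forall b, exists B : W1 -> W, [/\ linear B, B w1 = f2 b &
    forall x Q a, B (act (cur x Q) a) = act (cur x (q * Q)) (B a)].
  move=> b; apply: (generated_ind (U := [set b | exists B : W1 -> W, [/\ linear B,
    B w1 = f2 b & forall x Q a, B (act (cur x Q) a) = act (cur x (q * Q)) (B a)]]%classic)
    gen2); last by exists f1; split; rewrite // f1w f2w.
  apply: cur_submodule => [|y R c [B [lB Bw hB]]].
    split=> [|c b1 b2 [B1 [lB1 Bw1 hB1]] [B2 [lB2 Bw2 hB2]]].
      exists (fun=> 0); split=> [c a a'||x Q a]; first by rewrite scaler0 addr0.
        by rewrite linear_zero.
      by rewrite act0r.
    exists (fun a => c *: B1 a + B2 a); split=> [d a a'||x Q a].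
    - rewrite lB1 lB2 !scalerDr !scalerA [c * d]mulrC.
      by rewrite [LHS]addrACA.
    - by rewrite Bw1 Bw2 lf2.
    - by rewrite hB1 hB2 actDr actZr.
  exists (fun a => act (cur y (p * R)) (B a)); split=> [d a a'||x Q a].
  - by rewrite lB actDr actZr.
  - by rewrite Bw hf2.
  - by rewrite hB comm.
pose b2 a b := B b a.
have B_unique b (B' : W1 -> W) : linear B' -> B' w1 = f2 b ->
    (forall x Q a, B' (act (cur x Q) a) = act (cur x (q * Q)) (B' a)) -> B b =1 B'.
  move=> lB' B'w hB'; have [lB Bw hB] := BP b.
  by apply: (twisted_hom_unique lB lB' hB hB'); rewrite Bw B'w.
have bil : bilinear_for *:%R *:%R b2.
  split=> [b|a] c x y; first by have [lB _ _] := BP b; exact: lB.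
  have [lx xw hx] := BP x; have [ly yw hy] := BP y.
  rewrite /b2 (B_unique _ (fun a => c *: B x a + B y a)) // => [d a1 a2||z Q a1].
  - rewrite lx ly !scalerDr !scalerA [c * d]mulrC.
    by rewrite [LHS]addrACA.
  - by rewrite xw yw lf2.
  - by rewrite hx hy actDr actZr.
have b2_act2 y R a b : b2 a (act (cur y R) b) = act (cur y (p * R)) (b2 a b).
  have [lb bw hb] := BP b.
  rewrite /b2 (B_unique _ (fun a => act (cur y (p * R)) (B b a))) // => [d a1 a2||z Q a1].
  - by rewrite lb actDr actZr.
  - by rewrite bw hf2.
  - by rewrite hb comm.
pose T : tensor_module W1 W2 -> W := tensor_lift b2.
have lT : linear T := tensor_lift_linear bil.
have T_tens a b : T (tens a b) = b2 a b := tensor_lift_tens a b bil.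
have TD s t : T (s + t) = T s + T t by have := lT 1 s t; rewrite !scale1r.
have hT : is_module_hom T.
  apply: (cur_module_hom lT) => x Q; apply: tensor_ind => [|a b t IH].
    by rewrite act0r (linear_zero lT) act0r.
  rewrite actDr !TD IH actDr; congr (_ + _).
  rewrite act_tens TD !T_tens b2_act2; have [_ _ hb] := BP b.
  by rewrite /b2 hb -actDl -curDr -mulrDl qp mul1r.
have cycT := tensor_weyl_cyclic hW1.1 hW2.1 qp kill1 kill2.
have [_ genT _ _] := cycT.
have [F [hF Fw _]] := univW _ _ cycT.
have Tw : T (tens w1 w2) = w.
  by rewrite T_tens /b2; have [_ -> _] := BP w2.
exists F; split=> //; exists T.
- apply: (generated_ind (U := [set y | T (F y) = y]%classic) genW); last first.
    by rewrite /= Fw.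
  split; first split=> [|c y z /= yE zE]; rewrite /= ?linear0 ?(linear_zero lT) //.
    by rewrite linearP lT yE zE.
  by move=> s y /= yE; rewrite hF hT yE.
- apply: (generated_ind (U := [set t | F (T t) = t]%classic) genT); last first.
    by rewrite /= Tw.
  split; first split=> [|c y z /= yE zE]; rewrite /= ?(linear_zero lT) ?linear0 //.
    by rewrite lT linearP yE zE.
  by move=> s y /= yE; rewrite hT hF yE.
Qed.

End Factorization.

Local Open Scope complex_scope.

Theorem theorem2 (R : realType) (g : finLieAlgType R[i])
    (g_semisimple : semisimple g) (D : chevalleyData g)
    (M : affineVariety R[i]) (lam lam' : dominantWeight D)
    (Z : multiset M lam) (Z' : multiset M lam')
    (disjZ : forall i j i' j', tnth (Z i) j <> tnth (Z' i') j')
    (W W1 W2 : lieModule (current g M)) (w : W) (w1 : W1) (w2 : W2)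
    (hW : is_local_weyl (multiset_union Z Z') w)
    (hW1 : is_local_weyl Z w1) (hW2 : is_local_weyl Z' w2) :
  module_isomorphic W (tensor_module W1 W2).
Proof. exact: (weyl_tensor_isomorphism disjZ hW hW1 hW2). Qed.
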